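(* Let $M$ be a smooth manifold with complex structures $I,J$, a real Poisson structure $Q$ such that $(I,IQ+iQ)$ and $(J,JQ+iQ)$ are holomorphic Poisson structures, and a real closed 2-form $F\in\Omega^2_{cl}(M,\mathbb{R})$ satisfying $$J-I=QF,\qquad FJ+I^*F=0.$$ Suppose that $F$ is positive, i.e. the symmetric tensor $g=-\tfrac12F(I+J)$ is positive-definite. Let $\omega_I=gI$ and $\omega_J=gJ$. Then the pair $$\mathcal{J}_B=\frac12\begin{pmatrix}1&0\\ b&1\end{pmatrix}\begin{pmatrix}J+I&-(\omega_J^{-1}-\omega_I^{-1})\\ \omega_J-\omega_I&-(J^*+I^* )\end{pmatrix}\begin{pmatrix}1&0\\ -b&1\end{pmatrix},$$ $$\mathcal{J}_A=\frac12\begin{pmatrix}1&0\\ b&1\end{pmatrix}\begin{pmatrix}J-I&-(\omega_J^{-1}+\omega_I^{-1})\\ \omega_J+\omega_I&-(J^*-I^* )\end{pmatrix}\begin{pmatrix}1&0\\ -b&1\end{pmatrix}$$ defines a generalized Kähler structure on the standard Courant algebroid $(T\oplus T^*,[\cdot,\cdot]_0)$, for $b\in\Omega^2(M,\mathbb{R})$ given by $$b=-\tfrac12F(J-I).$$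
   Context: 2-forms and symmetric 2-tensors are viewed as maps $T\to T^*$ ($F:X\mapsto i_XF$), bivectors as maps $T^*\to T$, and juxtaposition is composition; $I^*,J^*$ are transposes. Matrices act on columns $(X,\xi)\in T\oplus T^*$. A holomorphic Poisson structure $(I,\sigma)$ is an integrable complex structure $I$ with a holomorphic section $\sigma$ of $\wedge^2T_{1,0}$ with $[\sigma,\sigma]=0$. The standard Courant algebroid is $T\oplus T^*$ with pairing $\langle X+\xi,Y+\eta\rangle=\xi(Y)+\eta(X)$ and bracket $[X+\xi,Y+\eta]_0=[X,Y]+L_X\eta-i_Yd\xi$. A generalized complex structure is an orthogonal endomorphism $\mathcal{J}$ with $\mathcal{J}^2=-1$ whose $+i$-eigenbundle is closed under the Courant bracket. A generalized Kähler structure is a pair $(\mathcal{J}_A,\mathcal{J}_B)$ of commuting generalized complex structures such that $G(\cdot,\cdot)=\langle\mathcal{J}_A\cdot,\mathcal{J}_B\cdot\rangle$ is a generalized Riemannian metric, i.e. $G=\langle\cdot,\cdot\rangle|_{C_+}-\langle\cdot,\cdot\rangle|_{C_-}$ for a maximal positive-definite subbundle $C_+$ and $C_-=C_+^\perp$. *)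

(* Defs.v *)
From HB Require Import structures.
From mathcomp Require Import all_boot all_order all_algebra.
From mathcomp Require Import all_classical all_reals all_analysis.
From mathcomp Require Import complex.
Set Implicit Arguments.
Unset Strict Implicit.
Unset Printing Implicit Defensive.
Import Order.TTheory GRing.Theory Num.Theory.
Import numFieldNormedType.Exports.
Local Open Scope classical_set_scope.
Local Open Scope ring_scope.

Definition pd (R : realType) (n : nat) (k : 'I_n) (f : 'cV[R]_n -> R)
    (x : 'cV[R]_n) : R :=
  'D_(delta_mx k 0) f x.

(* All partial derivatives of order at most [k] exist and are continuous. *)
Fixpoint Ck (R : realType) (n k : nat) (V : set 'cV[R]_n)
    (f : 'cV[R]_n -> R) : Prop :=
  (forall x, V x -> {for x, continuous f}) /\
  (if k is k'.+1 then
     forall i : 'I_n, (forall x, V x -> derivable f x (delta_mx i 0)) /\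
                      Ck k' V (pd i f)
   else True).

Definition smooth (R : realType) (n : nat) (V : set 'cV[R]_n)
    (f : 'cV[R]_n -> R) : Prop :=
  forall k, Ck k V f.

Definition smooth_mx (R : realType) (n p q : nat) (V : set 'cV[R]_n)
    (A : 'cV[R]_n -> 'M[R]_(p, q)) : Prop :=
  forall i j, smooth V (fun x => A x i j).

Definition smooth_mxC (R : realType) (n p q : nat) (V : set 'cV[R]_n)
    (A : 'cV[R]_n -> 'M[R[i]]_(p, q)) : Prop :=
  forall i j, smooth V (fun x => complex.Re (A x i j)) /\
              smooth V (fun x => complex.Im (A x i j)).

Definition pdC (R : realType) (n : nat) (k : 'I_n) (f : 'cV[R]_n -> R[i])
    (x : 'cV[R]_n) : R[i] :=
  Complex (pd k (fun y => complex.Re (f y)) x)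
          (pd k (fun y => complex.Im (f y)) x).

Definition complexify (R : realType) (p q : nat) (A : 'M[R]_(p, q)) :
    'M[R[i]]_(p, q) :=
  map_mx (real_complex R) A.

(* The smooth structure is given by an atlas, not required to be maximal;
   [icoord c] is the inverse of [coord c] on the chart domain. *)
Record manifold (R : realType) (n : nat) := Manifold {
  points :> topologicalType;
  chart : Type;
  dom : chart -> set points;
  coord : chart -> points -> 'cV[R]_n;
  icoord : chart -> 'cV[R]_n -> points;
  points_hausdorff : hausdorff_space points;
  points_second_countable : @second_countable points;
  dom_cover : forall p : points, exists c, dom c p;
  dom_open : forall c, open (dom c);
  coord_open : forall c, open (coord c @` dom c);
  coordK : forall c p, dom c p -> icoord c (coord c p) = p;
  coord_continuous : forall c, {within dom c, continuous (coord c)};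
  icoord_continuous :
    forall c, {within coord c @` dom c, continuous (icoord c)};
  transition_smooth : forall c d,
    smooth_mx (coord c @` (dom c `&` dom d))
              (fun x => coord d (icoord c x))
}.

Arguments chart {R n} M : rename.
Arguments dom {R n M} c _ : rename.
Arguments coord {R n M} c _ : rename.
Arguments icoord {R n M} c _ : rename.

Definition chart_image (R : realType) (n : nat) (M : manifold R n)
    (c : chart M) : set 'cV[R]_n :=
  coord c @` dom c.

Definition transition_jac (R : realType) (n : nat) (M : manifold R n)
    (c d : chart M) (x : 'cV[R]_n) : 'M[R]_n :=
  \matrix_(i, j) pd j (fun y => coord d (icoord c y) i 0) x.

(* A field is given by its components in every chart, as functions of the
   coordinates; only the values on [chart_image c] are meaningful.  Tangent and
   cotangent vectors are columns of components, so a 2-form F is the matrix of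
   X |-> i_X F, with (i, j) entry F(d_j, d_i), and a bivector is the matrix
   of a map from T^* to T. *)
Definition field (R : realType) (n : nat) (M : manifold R n) (T : Type) :
    Type :=
  chart M -> 'cV[R]_n -> T.

Definition endomorphism_field (R : realType) (n : nat) (M : manifold R n)
    (A : field M 'M[R]_n) : Prop :=
  (forall c, smooth_mx (chart_image c) (A c)) /\
  (forall (c d : chart M) (p : M), dom c p -> dom d p ->
     let D := transition_jac c d (coord c p) in
     A d (coord d p) *m D = D *m A c (coord c p)).

Definition two_form (R : realType) (n : nat) (M : manifold R n)
    (F : field M 'M[R]_n) : Prop :=
  [/\ forall c, smooth_mx (chart_image c) (F c),
      forall (c d : chart M) (p : M), dom c p -> dom d p ->
        let D := transition_jac c d (coord c p) in
        F c (coord c p) = D^T *m F d (coord d p) *m D &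
      forall c x, chart_image c x -> (F c x)^T = - F c x].

Definition closed_two_form (R : realType) (n : nat) (M : manifold R n)
    (F : field M 'M[R]_n) : Prop :=
  two_form F /\
  forall c x, chart_image c x -> forall i j k : 'I_n,
    pd i (fun y => F c y j k) x + pd j (fun y => F c y k i) x +
    pd k (fun y => F c y i j) x = 0.

Definition bivectorC (R : realType) (n : nat) (M : manifold R n)
    (s : field M 'M[R[i]]_n) : Prop :=
  [/\ forall c, smooth_mxC (chart_image c) (s c),
      forall (c d : chart M) (p : M), dom c p -> dom d p ->
        let D := complexify (transition_jac c d (coord c p)) in
        s d (coord d p) = D *m s c (coord c p) *m D^T &
      forall c x, chart_image c x -> (s c x)^T = - s c x].

(* Up to a nonzero constant factor, the components of the Schouten bracket
   [s, s]. *)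
Definition schouten (R : realType) (n : nat) (s : 'cV[R]_n -> 'M[R[i]]_n)
    (x : 'cV[R]_n) (i j k : 'I_n) : R[i] :=
  \sum_(l < n) (s x i l * pdC l (fun y => s y j k) x +
                s x j l * pdC l (fun y => s y k i) x +
                s x k l * pdC l (fun y => s y i j) x).

Definition poissonC (R : realType) (n : nat) (M : manifold R n)
    (s : field M 'M[R[i]]_n) : Prop :=
  bivectorC s /\
  forall c x, chart_image c x -> forall i j k, schouten (s c) x i j k = 0.

Definition real_poisson (R : realType) (n : nat) (M : manifold R n)
    (Q : field M 'M[R]_n) : Prop :=
  poissonC (M := M) (fun c x => complexify (Q c x)).

Definition lie_bracket (R : realType) (n : nat)
    (X Y : 'cV[R]_n -> 'cV[R[i]]_n) (x : 'cV[R]_n) : 'cV[R[i]]_n :=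
  \col_i \sum_(k < n) (X x k 0 * pdC k (fun y => Y y i 0) x -
                       Y x k 0 * pdC k (fun y => X y i 0) x).

Definition T10 (R : realType) (n : nat) (I : 'M[R]_n) : set 'cV[R[i]]_n :=
  [set Z | complexify I *m Z = ('i%C : R[i]) *: Z].

Definition T01 (R : realType) (n : nat) (I : 'M[R]_n) : set 'cV[R[i]]_n :=
  [set Z | complexify I *m Z = - (('i%C : R[i]) *: Z)].

(* Involutivity is tested on smooth sections over all open subsets of the
   charts. *)
Definition complex_structure (R : realType) (n : nat) (M : manifold R n)
    (I : field M 'M[R]_n) : Prop :=
  [/\ endomorphism_field I,
      forall c x, chart_image c x -> I c x *m I c x = - 1%:M &
      forall (c : chart M) (V : set 'cV[R]_n) (X Y : 'cV[R]_n -> 'cV[R[i]]_n),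
        open V -> V `<=` chart_image c -> smooth_mxC V X -> smooth_mxC V Y ->
        (forall x, V x -> T10 (I c x) (X x) /\ T10 (I c x) (Y x)) ->
        forall x, V x -> T10 (I c x) (lie_bracket X Y x)].

Definition lie_bivector (R : realType) (n : nat)
    (Z : 'cV[R]_n -> 'cV[R[i]]_n) (s : 'cV[R]_n -> 'M[R[i]]_n)
    (x : 'cV[R]_n) : 'M[R[i]]_n :=
  \matrix_(i, j) \sum_(k < n) (Z x k 0 * pdC k (fun y => s y i j) x -
                               pdC k (fun y => Z y i 0) x * s x k j -
                               pdC k (fun y => Z y j 0) x * s x i k).

(* The image of [s] lies in T_{1,0}, so that s is a section of wedge^2 T_{1,0},
   and s is killed by the Dolbeault operator: on T_{1,0} the latter is
   dbar_Z W = [Z, W]^{1,0} for Z in T_{0,1}, so dbar_Z s is the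
   (2,0)-component of L_Z s, which is read off by pairing with (1,0)-covectors
   (those a with I^* a = i a). *)
Definition holomorphic_bivector (R : realType) (n : nat) (M : manifold R n)
    (I : field M 'M[R]_n) (s : field M 'M[R[i]]_n) : Prop :=
  [/\ bivectorC s,
      forall c x, chart_image c x ->
        complexify (I c x) *m s c x = ('i%C : R[i]) *: s c x &
      forall (c : chart M) (V : set 'cV[R]_n) (Z : 'cV[R]_n -> 'cV[R[i]]_n),
        open V -> V `<=` chart_image c -> smooth_mxC V Z ->
        (forall x, V x -> T01 (I c x) (Z x)) ->
        forall x, V x -> forall a b : 'cV[R[i]]_n,
          T10 (I c x)^T a -> T10 (I c x)^T b ->
          a^T *m lie_bivector Z (s c) x *m b = 0].

Definition holomorphic_poisson (R : realType) (n : nat) (M : manifold R n)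
    (I : field M 'M[R]_n) (s : field M 'M[R[i]]_n) : Prop :=
  [/\ complex_structure I, holomorphic_bivector I s & poissonC s].

(* Vectors of T + T^* are columns [col_mx X xi]. *)
Definition pairing (R : realType) (n : nat) (u v : 'cV[R]_(n + n)) : R :=
  ((dsubmx u)^T *m usubmx v + (dsubmx v)^T *m usubmx u) 0 0.

(* The bracket [X + xi, Y + eta]_0 = [X, Y] + L_X eta - i_Y d xi, extended
   complex bilinearly. *)
Definition courant_bracket (R : realType) (n : nat)
    (u v : 'cV[R]_n -> 'cV[R[i]]_(n + n)) (x : 'cV[R]_n) :
    'cV[R[i]]_(n + n) :=
  let X y := usubmx (u y) in let xi y := dsubmx (u y) in
  let Y y := usubmx (v y) in let eta y := dsubmx (v y) in
  col_mx (lie_bracket X Y x)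
    (\col_i \sum_(k < n)
       (X x k 0 * pdC k (fun y => eta y i 0) x +
        eta x k 0 * pdC i (fun y => X y k 0) x -
        Y x k 0 * (pdC k (fun y => xi y i 0) x -
                   pdC i (fun y => xi y k 0) x))).

Definition transition_TTs (R : realType) (n : nat) (M : manifold R n)
    (c d : chart M) (x : 'cV[R]_n) : 'M[R]_(n + n) :=
  let D := transition_jac c d x in block_mx D 0 0 (invmx D)^T.

Definition eigen_i (R : realType) (m : nat) (A : 'M[R]_m) :
    set 'cV[R[i]]_m :=
  [set u | complexify A *m u = ('i%C : R[i]) *: u].

Definition generalized_complex (R : realType) (n : nat) (M : manifold R n)
    (A : field M 'M[R]_(n + n)) : Prop :=
  [/\ forall c, smooth_mx (chart_image c) (A c),
      forall (c d : chart M) (p : M), dom c p -> dom d p ->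
        let D := transition_TTs c d (coord c p) in
        A d (coord d p) *m D = D *m A c (coord c p),
      forall c x, chart_image c x -> forall u v : 'cV[R]_(n + n),
        pairing (A c x *m u) (A c x *m v) = pairing u v,
      forall c x, chart_image c x -> A c x *m A c x = - 1%:M &
      forall (c : chart M) (V : set 'cV[R]_n)
             (u v : 'cV[R]_n -> 'cV[R[i]]_(n + n)),
        open V -> V `<=` chart_image c -> smooth_mxC V u -> smooth_mxC V v ->
        (forall x, V x -> eigen_i (A c x) (u x) /\ eigen_i (A c x) (v x)) ->
        forall x, V x -> eigen_i (A c x) (courant_bracket u v x)].

Definition subbundle (R : realType) (n : nat) (M : manifold R n)
    (C : field M (set 'cV[R]_(n + n))) : Prop :=
  (forall (c d : chart M) (p : M), dom c p -> dom d p ->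
     forall u, C c (coord c p) u <->
               C d (coord d p) (transition_TTs c d (coord c p) *m u)) /\
  (forall (c : chart M) (x0 : 'cV[R]_n), chart_image c x0 ->
     exists (k : nat) (V : set 'cV[R]_n) (E : 'cV[R]_n -> 'M[R]_(n + n, k)),
       [/\ open V, V x0, V `<=` chart_image c, smooth_mx V E &
           forall x, V x -> \rank (E x) = k /\
             C c x = [set u | exists a : 'cV[R]_k, u = E x *m a]]).

Definition positive_definite_on (R : realType) (n : nat) (M : manifold R n)
    (C : field M (set 'cV[R]_(n + n))) : Prop :=
  forall (c : chart M) x, chart_image c x ->
    forall u, C c x u -> u != 0 -> 0 < pairing u u.

Definition maximal_positive_definite (R : realType) (n : nat)
    (M : manifold R n) (C : field M (set 'cV[R]_(n + n))) : Prop :=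
  [/\ subbundle C, positive_definite_on C &
      forall C', subbundle C' -> positive_definite_on C' ->
        (forall (c : chart M) x, chart_image c x -> C c x `<=` C' c x) ->
        forall (c : chart M) x, chart_image c x -> C' c x = C c x].

Definition orthogonal_complement (R : realType) (n : nat)
    (S : set 'cV[R]_(n + n)) : set 'cV[R]_(n + n) :=
  [set u | forall v, S v -> pairing u v = 0].

Definition generalized_metric (R : realType) (n : nat) (M : manifold R n)
    (G : field M ('cV[R]_(n + n) -> 'cV[R]_(n + n) -> R)) : Prop :=
  exists C : field M (set 'cV[R]_(n + n)),
    maximal_positive_definite C /\
    forall (c : chart M) x, chart_image c x ->
      forall u1 v1 u2 v2, C c x u1 -> C c x v1 ->
        orthogonal_complement (C c x) u2 -> orthogonal_complement (C c x) v2 ->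
        G c x (u1 + u2) (v1 + v2) = pairing u1 v1 - pairing u2 v2.

Definition generalized_kaehler (R : realType) (n : nat) (M : manifold R n)
    (JA JB : field M 'M[R]_(n + n)) : Prop :=
  [/\ generalized_complex JA, generalized_complex JB,
      forall c x, chart_image c x -> JA c x *m JB c x = JB c x *m JA c x &
      generalized_metric (M := M)
        (fun c x u v => pairing (JA c x *m u) (JB c x *m v))].

Definition positive_definite_field (R : realType) (n : nat)
    (M : manifold R n) (g : field M 'M[R]_n) : Prop :=
  forall (c : chart M) x, chart_image c x ->
    forall X : 'cV[R]_n, X != 0 -> 0 < (X^T *m g c x *m X) 0 0.

(* Main.v *)
(** The graphs [C_+], [C_-] of [b + g = - F J] and [b - g = F I] split T + T^*.
    On [C_+] both [J_A] and [J_B] act as J, while on [C_-] they act as [- I] and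
    [I] respectively; this gives all the pointwise claims.
    The [+i]-eigenbundle of [J_A] is the graph of the closed 2-form [- i F],
    hence involutive.  That of [J_B] consists of the sums of vectors [X - i F X]
    with X in T_{1,0} of J and [Y + i F Y] with Y in T_{1,0} of I.  Brackets of
    two sections of the same kind are covered by the integrability of I and J
    and by [d F = 0].  For a mixed bracket, the gauge transformation by [i F]
    leaves [[X, Y + 2 i F Y]]; here [F Y] lies in T^*_{0,1} of J, and
    [J Y = i Y + Q F Y], so that closure under this bracket is the holomorphy
    of the bivector [J Q + i Q]. *)

Require Import Defs.
From HB Require Import structures.
From mathcomp Require Import all_boot all_order all_algebra.
From mathcomp Require Import all_classical all_reals all_analysis.
From mathcomp Require Import complex.
From mathcomp Require Import ring.
Set Implicit Arguments.
Unset Strict Implicit.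
Unset Printing Implicit Defensive.
Import Order.TTheory GRing.Theory Num.Theory.
Import numFieldNormedType.Exports.
Local Open Scope classical_set_scope.
Local Open Scope ring_scope.

(** * Smooth functions *)

(** The forms [b + g] and [b - g] need not be closed, and the given blocks contain inverse matrices.
    Both difficulties disappear in the frame of lifts to C_+ and C_-: the structures become block
    diagonal there, and on [+i]-eigenvectors the lifts are graphs of the closed forms [- i F] and
    [i F]. All invertibility comes from positivity: [g] is invertible, hence so are [F], the frame
    and the Jacobians of the transition maps. For the mixed bracket put L = [X, Y], beta = F Y and
    let gamma be the Lie derivative of beta along X. After the gauge transformation, (L, 2 i gamma)
    must be the sum of Z1 and Z2 + 2 i F Z2, which forces Z2 = F^-1 gamma. Then Z2 and Z1 = L - Z2
    have the required types exactly when J^T gamma = - i gamma and J L = i L + Q gamma. The pair (Y,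
    beta) satisfies these same two equations, so the task is to show that they survive the Lie
    derivative along X. *)

Section Smooth.
Variables (R : realType) (n : nat).
Implicit Types (U V : set 'cV[R]_n) (f g : 'cV[R]_n -> R).

Lemma Ck_subset k U V f : U `<=` V -> Ck k V f -> Ck k U f.
Proof.
move=> UV; elim: k f => [|k IH] f /= [fc fd]; split=> //.
- by move=> x /UV; apply: fc.
- by move=> x /UV; apply: fc.
by move=> i; have [di ki] := fd i; split=> [x /UV|]; [apply: di|apply: IH].
Qed.

Lemma CkS k V f : Ck k.+1 V f -> Ck k V f.
Proof.
elim: k f => [|k IH] f; first by case=> fc _; split.
case=> fc fd; split=> // i; have [di ki] := fd i; split=> //.
exact: IH.
Qed.

(** Fields are controlled only on [V]; openness turns this into control near a point, which is what
    limits and derivatives see. *)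
Lemma near_open V (P : 'cV[R]_n -> Prop) x :
  open V -> V x -> (forall y, V y -> P y) -> \forall y \near x, P y.
Proof. by move=> oV Vx VP; apply: filterS VP _; exact: open_nbhs_nbhs. Qed.

Lemma pd_congr V f g i x : open V -> V x -> (forall y, V y -> f y = g y) ->
  pd i f x = pd i g x.
Proof. by move=> oV Vx fg; apply/near_eq_derive/(near_open oV Vx). Qed.

Lemma derivable_congr V f g v x : open V -> V x ->
  (forall y, V y -> f y = g y) -> derivable f x v -> derivable g x v.
Proof. by move=> oV Vx fg; apply/near_eq_derivable/(near_open oV Vx). Qed.

Lemma continuous_congr V f g x : open V -> V x ->
  (forall y, V y -> f y = g y) ->
  {for x, continuous f} -> {for x, continuous g}.
Proof.
move=> oV Vx fg cf; rewrite /prop_for /continuous_at -(fg x Vx).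
apply: cvg_trans cf.
exact: (@near_eq_cvg _ _ (nbhs x) _ f g (near_open oV Vx fg)).
Qed.

Lemma Ck_congr k V f g : open V -> (forall x, V x -> f x = g x) ->
  Ck k V f -> Ck k V g.
Proof.
move=> oV; elim: k f g => [|k IH] f g fg /= [fc fd]; split=> //.
- by move=> x Vx; apply: (continuous_congr oV Vx fg (fc x Vx)).
- by move=> x Vx; apply: (continuous_congr oV Vx fg (fc x Vx)).
move=> i; have [di ki] := fd i; split=> [x Vx|].
  exact: (derivable_congr oV Vx fg (di x Vx)).
by apply: IH ki => x Vx; apply: (pd_congr _ oV Vx).
Qed.

Lemma pdD f g i x : derivable f x (delta_mx i 0) ->
  derivable g x (delta_mx i 0) ->
  pd i (fun y => f y + g y) x = pd i f x + pd i g x.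
Proof. by move=> df dg; exact: (deriveD df dg). Qed.

Lemma pdM f g i x : derivable f x (delta_mx i 0) ->
  derivable g x (delta_mx i 0) ->
  pd i (fun y => f y * g y) x = pd i f x * g x + f x * pd i g x.
Proof.
by move=> df dg; rewrite /pd (deriveM df dg) /GRing.scale /= addrC mulrC.
Qed.

Lemma pdN f i x : derivable f x (delta_mx i 0) ->
  pd i (fun y => - f y) x = - pd i f x.
Proof. by move=> df; exact: (deriveN df). Qed.

Lemma pd_cst (a : R) i x : pd (n := n) i (fun=> a) x = 0.
Proof. exact: derive_cst. Qed.

Lemma Ck_cst k V (a : R) : Ck k V (fun=> a).
Proof.
have cc x : {for x, continuous (fun _ : 'cV[R]_n => a)}.
  by have := @cst_continuous 'cV[R]_n R a; apply.
elim: k a cc => [|k IH] a cc /=; split; try by move=> x _; exact: cc.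
  by [].
move=> i; split; first by move=> x _; exact: derivable_cst.
have -> : pd i (fun=> a) = (fun _ : 'cV[R]_n => 0).
  by apply/funext => x; rewrite pd_cst.
by apply: IH => x; have := @cst_continuous 'cV[R]_n R 0; apply.
Qed.

Lemma CkD k V f g : open V -> Ck k V f -> Ck k V g ->
  Ck k V (fun x => f x + g x).
Proof.
move=> oV; elim: k f g => [|k IH] f g /= [fc fd] [gc gd]; split=> //;
  try by move=> x Vx; apply: continuousD; [exact: fc|exact: gc].
move=> i; have [df kf] := fd i; have [dg kg] := gd i; split=> [x Vx|].
  by apply: derivableD; [exact: df|exact: dg].
apply: (Ck_congr (f := fun x => pd i f x + pd i g x)) => //; last exact: IH.
by move=> x Vx; rewrite pdD//; [exact: df|exact: dg].
Qed.

Lemma CkM k V f g : open V -> Ck k V f -> Ck k V g ->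
  Ck k V (fun x => f x * g x).
Proof.
move=> oV; elim: k f g => [|k IH] f g Cf Cg; move: (Cf) (Cg);
  case=> fc fd [gc gd]; split=> //;
  try by move=> x Vx; apply: continuousM; [exact: fc|exact: gc].
move=> i; have [df kf] := fd i; have [dg kg] := gd i; split=> [x Vx|].
  by apply: derivableM; [exact: df|exact: dg].
apply: (Ck_congr (f := fun x => pd i f x * g x + f x * pd i g x)) => //.
  by move=> x Vx; rewrite pdM//; [exact: df|exact: dg].
by apply: CkD => //; apply: IH => //; exact: CkS.
Qed.

(** The derivative is [- f^-2] times that of [f], so order [k] for the inverse itself yields order
    [k + 1]. *)
Lemma CkV k V f : open V -> (forall x, V x -> f x != 0) -> Ck k V f ->
  Ck k V (fun x => (f x)^-1).
Proof.
move=> oV f0; elim: k => [|k IH] Cf; move: (Cf); case=> fc fd; split=> //;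
  try by move=> x Vx; apply: continuousV; [exact: f0|exact: fc].
move=> i; have [df kf] := fd i; split=> [x Vx|].
  by apply: derivableV; [exact: f0|exact: df].
have CV := IH (CkS Cf).
apply: (Ck_congr (f := fun x => (-1) * ((f x)^-1 * (f x)^-1) * pd i f x)) => //.
  move=> x Vx; rewrite [RHS]deriveV ?f0//; last exact: df.
  by rewrite mulN1r -expr2 exprVn.
by apply: CkM => //; apply: CkM => //; [exact: Ck_cst|exact: CkM].
Qed.

Lemma smooth_subset U V f : U `<=` V -> smooth V f -> smooth U f.
Proof. by move=> UV sf k; apply: Ck_subset (sf k). Qed.

Lemma smooth_congr V f g : open V -> (forall x, V x -> f x = g x) ->
  smooth V f -> smooth V g.
Proof. by move=> oV fg sf k; apply: Ck_congr (sf k). Qed.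

Lemma smooth_cst V (a : R) : smooth V (fun=> a).
Proof. by move=> k; exact: Ck_cst. Qed.

Lemma smoothD V f g : open V -> smooth V f -> smooth V g ->
  smooth V (fun x => f x + g x).
Proof. by move=> oV sf sg k; apply: CkD. Qed.

Lemma smoothM V f g : open V -> smooth V f -> smooth V g ->
  smooth V (fun x => f x * g x).
Proof. by move=> oV sf sg k; apply: CkM. Qed.

Lemma smoothV V f : open V -> (forall x, V x -> f x != 0) -> smooth V f ->
  smooth V (fun x => (f x)^-1).
Proof. by move=> oV f0 sf k; apply: CkV. Qed.

Lemma smoothZ V (a : R) f : open V -> smooth V f -> smooth V (fun x => a * f x).
Proof. by move=> oV; apply: smoothM => //; exact: smooth_cst. Qed.

Lemma smoothN V f : open V -> smooth V f -> smooth V (fun x => - f x).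
Proof.
move=> oV sf; apply: (smooth_congr (f := fun x => (-1) * f x)) => //.
  by move=> x _; rewrite mulN1r.
exact: smoothZ.
Qed.

Lemma smooth_sum V (K : Type) (r : seq K) (P : pred K)
    (f : K -> 'cV[R]_n -> R) : open V -> (forall i, P i -> smooth V (f i)) ->
  smooth V (fun x => \sum_(i <- r | P i) f i x).
Proof.
move=> oV sf; elim: r => [|i r IH].
  apply: (smooth_congr (f := fun=> 0)) => //; last exact: smooth_cst.
  by move=> x _; rewrite big_nil.
apply: (smooth_congr (f := fun x => if P i
  then f i x + \sum_(j <- r | P j) f j x
  else \sum_(j <- r | P j) f j x)) => //.
  by move=> x _; rewrite big_cons.
by case Pi: (P i) => //; apply: smoothD => //; exact: sf.
Qed.

Lemma smooth_prod V (K : Type) (r : seq K) (P : pred K)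
    (f : K -> 'cV[R]_n -> R) : open V -> (forall i, P i -> smooth V (f i)) ->
  smooth V (fun x => \prod_(i <- r | P i) f i x).
Proof.
move=> oV sf; elim: r => [|i r IH].
  apply: (smooth_congr (f := fun=> 1)) => //; last exact: smooth_cst.
  by move=> x _; rewrite big_nil.
apply: (smooth_congr (f := fun x => if P i
  then f i x * \prod_(j <- r | P j) f j x
  else \prod_(j <- r | P j) f j x)) => //.
  by move=> x _; rewrite big_cons.
by case Pi: (P i) => //; apply: smoothM => //; exact: sf.
Qed.

Lemma smooth_derivable V f x i : smooth V f -> V x ->
  derivable f x (delta_mx i 0).
Proof. by move=> sf Vx; have [_ /(_ i)[+ _]] := sf 1%N; apply. Qed.

Lemma smooth_mx_subset U V p q (A : 'cV[R]_n -> 'M[R]_(p, q)) : U `<=` V ->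
  smooth_mx V A -> smooth_mx U A.
Proof. by move=> UV sA i j; exact: smooth_subset (sA i j). Qed.

Lemma smooth_mx_congr V p q (A B : 'cV[R]_n -> 'M[R]_(p, q)) : open V ->
  (forall x, V x -> A x = B x) -> smooth_mx V A -> smooth_mx V B.
Proof.
move=> oV AB sA i j; apply: smooth_congr (sA i j) => // x Vx.
by rewrite AB.
Qed.

Lemma smooth_mx_cst V p q (A : 'M[R]_(p, q)) : smooth_mx V (fun=> A).
Proof. by move=> i j; exact: smooth_cst. Qed.

Lemma smooth_mxD V p q (A B : 'cV[R]_n -> 'M[R]_(p, q)) : open V ->
  smooth_mx V A -> smooth_mx V B -> smooth_mx V (fun x => A x + B x).
Proof.
by move=> oV sA sB i j; under eq_fun do rewrite mxE; exact: smoothD.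
Qed.

Lemma smooth_mxZ V p q (a : R) (A : 'cV[R]_n -> 'M[R]_(p, q)) : open V ->
  smooth_mx V A -> smooth_mx V (fun x => a *: A x).
Proof.
by move=> oV sA i j; under eq_fun do rewrite mxE; exact: smoothZ.
Qed.

Lemma smooth_mxN V p q (A : 'cV[R]_n -> 'M[R]_(p, q)) : open V ->
  smooth_mx V A -> smooth_mx V (fun x => - A x).
Proof.
by move=> oV sA i j; under eq_fun do rewrite mxE; exact: smoothN.
Qed.

Lemma smooth_mxM V p q r (A : 'cV[R]_n -> 'M[R]_(p, q))
    (B : 'cV[R]_n -> 'M[R]_(q, r)) : open V ->
  smooth_mx V A -> smooth_mx V B -> smooth_mx V (fun x => A x *m B x).
Proof.
move=> oV sA sB i j; under eq_fun do rewrite mxE.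
by apply: smooth_sum => // k _; exact: smoothM.
Qed.

Lemma smooth_block_mx V p1 p2 q1 q2 (A : 'cV[R]_n -> 'M[R]_(p1, q1))
    (B : 'cV[R]_n -> 'M[R]_(p1, q2)) (C : 'cV[R]_n -> 'M[R]_(p2, q1))
    (D : 'cV[R]_n -> 'M[R]_(p2, q2)) :
  smooth_mx V A -> smooth_mx V B -> smooth_mx V C -> smooth_mx V D ->
  smooth_mx V (fun x => block_mx (A x) (B x) (C x) (D x)).
Proof.
move=> sA sB sC sD i j.
case: (split_ordP i) => i' ->; case: (split_ordP j) => j' ->; under eq_fun do
  rewrite ?block_mxEul ?block_mxEur ?block_mxEdl ?block_mxEdr.
- exact: sA.
- exact: sB.
- exact: sC.
- exact: sD.
Qed.

Lemma smooth_det V p (A : 'cV[R]_n -> 'M[R]_p) : open V ->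
  smooth_mx V A -> smooth V (fun x => \det (A x)).
Proof.
move=> oV sA; apply: smooth_sum => // s _.
by apply: smoothZ => //; apply: smooth_prod.
Qed.

(** By Cramer's formula: cofactors are polynomials in the entries, and the determinant does not
    vanish. *)
Lemma smooth_invmx V p (A : 'cV[R]_n -> 'M[R]_p) : open V ->
  (forall x, V x -> A x \in unitmx) ->
  smooth_mx V A -> smooth_mx V (fun x => invmx (A x)).
Proof.
move=> oV uA sA; apply: (smooth_mx_congr
  (A := fun x => (\det (A x))^-1 *: \adj (A x))) => //.
  by move=> x Vx; rewrite /invmx uA.
move=> i j; under eq_fun do rewrite !mxE /cofactor.
apply: smoothM => //.
  apply: smoothV => //; last exact: smooth_det.
  by move=> x /uA; rewrite unitmxE unitfE.
apply: smoothZ => //; apply: smooth_det => // k l.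
by under eq_fun do rewrite !mxE; exact: sA.
Qed.

End Smooth.

(** * Derivatives of complex matrix-valued functions *)

Section ComplexSmooth.
Variables (R : realType) (n : nat) (V : set 'cV[R]_n).
Hypothesis oV : open V.
Implicit Types f g : 'cV[R]_n -> R[i].

Definition smoothC f : Prop :=
  smooth V (fun x => complex.Re (f x)) /\ smooth V (fun x => complex.Im (f x)).

Lemma smoothC_congr f g : (forall x, V x -> f x = g x) ->
  smoothC f -> smoothC g.
Proof.
move=> fg [sr si]; split; [apply: smooth_congr sr|apply: smooth_congr si] => //;
  by move=> x Vx; rewrite fg.
Qed.

Lemma smoothC_cst (a : R[i]) : smoothC (fun=> a).
Proof. by split; exact: smooth_cst. Qed.

Lemma ReM (a b : R[i]) : complex.Re (a * b) =
  complex.Re a * complex.Re b - complex.Im a * complex.Im b.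
Proof. by case: a b => [a1 a2] [b1 b2]. Qed.

Lemma ImM (a b : R[i]) : complex.Im (a * b) =
  complex.Re a * complex.Im b + complex.Im a * complex.Re b.
Proof. by case: a b => [a1 a2] [b1 b2]. Qed.

Lemma smoothCD f g : smoothC f -> smoothC g -> smoothC (fun x => f x + g x).
Proof.
move=> [fr fi] [gr gi]; split.
  apply: (smooth_congr
    (f := fun x => complex.Re (f x) + complex.Re (g x))) => //.
    by move=> x _; case: (f x) (g x) => [? ?] [? ?].
  exact: smoothD.
apply: (smooth_congr (f := fun x => complex.Im (f x) + complex.Im (g x))) => //.
  by move=> x _; case: (f x) (g x) => [? ?] [? ?].
exact: smoothD.
Qed.

Lemma smoothCM f g : smoothC f -> smoothC g -> smoothC (fun x => f x * g x).
Proof.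
move=> [fr fi] [gr gi]; split.
  apply: (smooth_congr (f := fun x => complex.Re (f x) * complex.Re (g x) +
    - (complex.Im (f x) * complex.Im (g x)))) => //.
    by move=> x _; rewrite ReM.
  by apply: smoothD => //; [|apply: smoothN => //]; exact: smoothM.
apply: (smooth_congr (f := fun x => complex.Re (f x) * complex.Im (g x) +
    complex.Im (f x) * complex.Re (g x))) => //.
  by move=> x _; rewrite ImM.
by apply: smoothD => //; exact: smoothM.
Qed.

Lemma smoothC_real (f : 'cV[R]_n -> R) : smooth V f ->
  smoothC (fun x => real_complex R (f x)).
Proof. by move=> sf; split => //; exact: smooth_cst. Qed.

Lemma smoothC_conj f : smoothC f -> smoothC (fun x => conjc (f x)).
Proof.
move=> [fr fi]; split.
  by apply: smooth_congr fr => // x _; case: (f x).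
apply: (smooth_congr (f := fun x => - complex.Im (f x))) => //.
  by move=> x _; case: (f x).
exact: smoothN.
Qed.

Lemma smoothC_sum (K : Type) (r : seq K) (P : pred K)
    (f : K -> 'cV[R]_n -> R[i]) : (forall i, P i -> smoothC (f i)) ->
  smoothC (fun x => \sum_(i <- r | P i) f i x).
Proof.
move=> sf; elim: r => [|i r IH].
  apply: (smoothC_congr (f := fun=> 0)) => //; last exact: smoothC_cst.
  by move=> x _; rewrite big_nil.
apply: (smoothC_congr (f := fun x => if P i
  then f i x + \sum_(j <- r | P j) f j x
  else \sum_(j <- r | P j) f j x)) => //.
  by move=> x _; rewrite big_cons.
by case Pi: (P i) => //; apply: smoothCD => //; exact: sf.
Qed.

Section Pd.
Variables (x : 'cV[R]_n) (k : 'I_n).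
Hypothesis Vx : V x.

Lemma pdC_congr f g : (forall y, V y -> f y = g y) -> pdC k f x = pdC k g x.
Proof.
move=> fg; rewrite /pdC; congr Complex; apply: (pd_congr k oV Vx) => y Vy;
  by rewrite fg.
Qed.

Lemma pdC_cst (a : R[i]) : pdC k (fun _ : 'cV[R]_n => a) x = 0.
Proof. by rewrite /pdC !pd_cst. Qed.

Lemma pdC_real (f : 'cV[R]_n -> R) :
  pdC k (fun y => real_complex R (f y)) x = real_complex R (pd k f x).
Proof. by rewrite /pdC /= pd_cst. Qed.

Lemma pdCD f g : smoothC f -> smoothC g ->
  pdC k (fun y => f y + g y) x = pdC k f x + pdC k g x.
Proof.
move=> [fr fi] [gr gi]; rewrite /pdC.
transitivity (Complex (pd k (fun y => complex.Re (f y) + complex.Re (g y)) x)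
  (pd k (fun y => complex.Im (f y) + complex.Im (g y)) x)).
  congr Complex; apply: (pd_congr k oV Vx) => y _;
    by case: (f y) (g y) => [? ?] [? ?].
by rewrite !pdD//; exact: (smooth_derivable (V := V)).
Qed.

Lemma pdCM f g : smoothC f -> smoothC g ->
  pdC k (fun y => f y * g y) x = pdC k f x * g x + f x * pdC k g x.
Proof.
move=> [fr fi] [gr gi]; rewrite /pdC.
transitivity (Complex
  (pd k (fun y => complex.Re (f y) * complex.Re (g y) +
                  - (complex.Im (f y) * complex.Im (g y))) x)
  (pd k (fun y => complex.Re (f y) * complex.Im (g y) +
                  complex.Im (f y) * complex.Re (g y)) x)).
  congr Complex; apply: (pd_congr k oV Vx) => y _; [exact: ReM|exact: ImM].
have dr := smooth_derivable (V := V) (i := k) fr Vx.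
have di := smooth_derivable (V := V) (i := k) fi Vx.
have er := smooth_derivable (V := V) (i := k) gr Vx.
have ei := smooth_derivable (V := V) (i := k) gi Vx.
have dM (a b : 'cV[R]_n -> R) (da : derivable a x (delta_mx k 0))
    (db : derivable b x (delta_mx k 0)) :
  derivable (fun y => a y * b y) x (delta_mx k 0) by exact: (derivableM da db).
rewrite (pdD (dM _ _ dr er) (derivableN (dM _ _ di ei))).
rewrite (pdD (dM _ _ dr ei) (dM _ _ di er)) (pdN (dM _ _ di ei)).
rewrite (pdM dr er) (pdM di ei) (pdM dr ei) (pdM di er).
apply/eqP; rewrite eq_complex !raddfD /= !ReM !ImM /=.
by apply/andP; split; apply/eqP; ring.
Qed.

Lemma pdC_conj f : smoothC f ->
  pdC k (fun y => conjc (f y)) x = conjc (pdC k f x).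
Proof.
move=> [fr fi]; rewrite /pdC /=; congr Complex.
  by apply: (pd_congr k oV Vx) => y _; case: (f y).
transitivity (pd k (fun y => - complex.Im (f y)) x).
  by apply: (pd_congr k oV Vx) => y _; case: (f y).
by rewrite pdN//; exact: (smooth_derivable (V := V)).
Qed.

Lemma pdC_sum (K : Type) (r : seq K) (P : pred K)
    (f : K -> 'cV[R]_n -> R[i]) : (forall i, smoothC (f i)) ->
  pdC k (fun y => \sum_(i <- r | P i) f i y) x =
  \sum_(i <- r | P i) pdC k (f i) x.
Proof.
move=> sf; elim: r => [|i r IH].
  rewrite big_nil; transitivity (pdC k (fun=> 0) x); last exact: pdC_cst.
  by apply: pdC_congr => y _; rewrite big_nil.
rewrite big_cons -IH; case Pi: (P i); last first.
  by apply: pdC_congr => y _; rewrite big_cons Pi.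
rewrite -pdCD//; last exact: smoothC_sum.
by apply: pdC_congr => y _; rewrite big_cons Pi.
Qed.

End Pd.

End ComplexSmooth.

Section MatrixCalculus.
Variables (R : realType) (n : nat) (V : set 'cV[R]_n).
Hypothesis oV : open V.
Local Notation C := R[i].

Lemma smooth_mxC_congr p q (A B : 'cV[R]_n -> 'M[C]_(p, q)) :
  (forall x, V x -> A x = B x) -> smooth_mxC V A -> smooth_mxC V B.
Proof.
move=> AB sA i j; apply: smoothC_congr (sA i j) => // x Vx.
by rewrite AB.
Qed.

Lemma smooth_mxC_cst p q (A : 'M[C]_(p, q)) : smooth_mxC V (fun=> A).
Proof. by move=> i j; exact: smoothC_cst. Qed.

Lemma smooth_mxCD p q (A B : 'cV[R]_n -> 'M[C]_(p, q)) :
  smooth_mxC V A -> smooth_mxC V B -> smooth_mxC V (fun x => A x + B x).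
Proof.
move=> sA sB i j.
apply: (smoothC_congr oV (f := fun x => A x i j + B x i j)).
  by move=> x _; rewrite mxE.
exact: smoothCD (sA i j) (sB i j).
Qed.

Lemma smooth_mxCZ p q (a : C) (A : 'cV[R]_n -> 'M[C]_(p, q)) :
  smooth_mxC V A -> smooth_mxC V (fun x => a *: A x).
Proof.
move=> sA i j; apply: (smoothC_congr oV (f := fun x => a * A x i j)).
  by move=> x _; rewrite mxE.
exact: (smoothCM oV (smoothC_cst V a) (sA i j)).
Qed.

Lemma smooth_mxCN p q (A : 'cV[R]_n -> 'M[C]_(p, q)) :
  smooth_mxC V A -> smooth_mxC V (fun x => - A x).
Proof.
move=> /(smooth_mxCZ (-1)); apply: smooth_mxC_congr => x _.
by rewrite scaleN1r.
Qed.

Lemma smooth_mxCM p q r (A : 'cV[R]_n -> 'M[C]_(p, q))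
    (B : 'cV[R]_n -> 'M[C]_(q, r)) :
  smooth_mxC V A -> smooth_mxC V B -> smooth_mxC V (fun x => A x *m B x).
Proof.
move=> sA sB i j.
apply: (smoothC_congr oV (f := fun x => \sum_k A x i k * B x k j)).
  by move=> x _; rewrite mxE.
by apply: smoothC_sum => // k _; exact: smoothCM (sA i k) (sB k j).
Qed.

Lemma smooth_mxC_complexify p q (A : 'cV[R]_n -> 'M[R]_(p, q)) :
  smooth_mx V A -> smooth_mxC V (fun x => complexify (A x)).
Proof.
move=> sA i j.
apply: (smoothC_congr oV (f := fun x => real_complex R (A x i j))).
  by move=> x _; rewrite mxE.
exact: smoothC_real (sA i j).
Qed.

Lemma smooth_mxC_conj p q (A : 'cV[R]_n -> 'M[C]_(p, q)) :
  smooth_mxC V A -> smooth_mxC V (fun x => map_mx conjc (A x)).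
Proof.
move=> sA i j; apply: (smoothC_congr oV (f := fun x => conjc (A x i j))).
  by move=> x _; rewrite mxE.
exact: smoothC_conj (sA i j).
Qed.

Lemma smooth_mxC_tr p q (A : 'cV[R]_n -> 'M[C]_(p, q)) :
  smooth_mxC V A -> smooth_mxC V (fun x => (A x)^T).
Proof.
move=> sA i j; apply: (smoothC_congr oV (f := fun x => A x j i)) (sA j i).
by move=> x _; rewrite mxE.
Qed.

Lemma smooth_mxC_usub p1 p2 q (A : 'cV[R]_n -> 'M[C]_(p1 + p2, q)) :
  smooth_mxC V A -> smooth_mxC V (fun x => usubmx (A x)).
Proof.
move=> sA i j; apply: (smoothC_congr oV (f := fun x => A x (lshift p2 i) j));
  [by move=> x _; rewrite mxE|exact: sA].
Qed.

Lemma smooth_mxC_dsub p1 p2 q (A : 'cV[R]_n -> 'M[C]_(p1 + p2, q)) :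
  smooth_mxC V A -> smooth_mxC V (fun x => dsubmx (A x)).
Proof.
move=> sA i j; apply: (smoothC_congr oV (f := fun x => A x (rshift p1 i) j));
  [by move=> x _; rewrite mxE|exact: sA].
Qed.

(** Derivative along a complex vector, extended linearly. Coordinate sums are recast through [dirD]
    and [jac] so that the Leibniz rule applies to whole matrix products. *)
Definition dirD p q (v : 'cV[C]_n) (A : 'cV[R]_n -> 'M[C]_(p, q))
    (x : 'cV[R]_n) : 'M[C]_(p, q) :=
  \matrix_(i, j) \sum_(k < n) v k 0 * pdC k (fun y => A y i j) x.

Definition jac p (X : 'cV[R]_n -> 'cV[C]_p) (x : 'cV[R]_n) : 'M[C]_(p, n) :=
  \matrix_(i, k) pdC k (fun y => X y i 0) x.

Lemma dirD_jac p (v : 'cV[C]_n) (X : 'cV[R]_n -> 'cV[C]_p) x :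
  dirD v X x = jac X x *m v.
Proof.
apply/matrixP => i j; rewrite !mxE ord1; apply: eq_bigr => k _.
by rewrite mxE mulrC.
Qed.

Section Point.
Variable x : 'cV[R]_n.
Hypothesis Vx : V x.
Implicit Type v : 'cV[C]_n.

Lemma dirD_congr p q v (A B : 'cV[R]_n -> 'M[C]_(p, q)) :
  (forall y, V y -> A y = B y) -> dirD v A x = dirD v B x.
Proof.
move=> AB; apply/matrixP => i j; rewrite !mxE; apply: eq_bigr => k _.
by congr (_ * _); apply: (pdC_congr oV k Vx) => y Vy; rewrite AB.
Qed.

Lemma dirD_cst p q v (A : 'M[C]_(p, q)) : dirD v (fun=> A) x = 0.
Proof.
apply/matrixP => i j; rewrite !mxE big1 // => k _.
by rewrite pdC_cst mulr0.
Qed.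

Lemma dirDD p q v (A B : 'cV[R]_n -> 'M[C]_(p, q)) :
  smooth_mxC V A -> smooth_mxC V B ->
  dirD v (fun y => A y + B y) x = dirD v A x + dirD v B x.
Proof.
move=> sA sB; apply/matrixP => i j; rewrite !mxE -big_split /=.
apply: eq_bigr => k _; rewrite -mulrDr; congr (_ * _).
rewrite -(pdCD oV k Vx (sA i j) (sB i j)).
by apply: (pdC_congr oV k Vx) => y _; rewrite mxE.
Qed.

Lemma dirDM p q r v (A : 'cV[R]_n -> 'M[C]_(p, q))
    (B : 'cV[R]_n -> 'M[C]_(q, r)) :
  smooth_mxC V A -> smooth_mxC V B ->
  dirD v (fun y => A y *m B y) x = dirD v A x *m B x + A x *m dirD v B x.
Proof.
move=> sA sB; apply/matrixP => i j; rewrite !mxE.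
transitivity (\sum_k \sum_l v k 0 *
  (pdC k (fun y => A y i l) x * B x l j +
   A x i l * pdC k (fun y => B y l j) x)).
  apply: eq_bigr => k _; rewrite -mulr_sumr; congr (_ * _).
  transitivity (pdC k (fun y => \sum_l A y i l * B y l j) x).
    by apply: (pdC_congr oV k Vx) => y _; rewrite mxE.
  rewrite (pdC_sum oV k Vx).
    by apply: eq_bigr => l _; exact: (pdCM oV k Vx (sA i l) (sB l j)).
  by move=> l; exact: smoothCM (sA i l) (sB l j).
rewrite exchange_big -big_split /=; apply: eq_bigr => l _; rewrite !mxE.
rewrite mulr_suml mulr_sumr -big_split /=; apply: eq_bigr => k _.
by ring.
Qed.

Lemma dirDZ p q v (a : C) (A : 'cV[R]_n -> 'M[C]_(p, q)) :
  smooth_mxC V A -> dirD v (fun y => a *: A y) x = a *: dirD v A x.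
Proof.
move=> sA; transitivity (dirD v (fun y => a%:M *m A y) x).
  by apply: dirD_congr => y _; rewrite mul_scalar_mx.
rewrite dirDM//; last exact: smooth_mxC_cst.
by rewrite dirD_cst mul0mx add0r mul_scalar_mx.
Qed.

Lemma dirDN p q v (A : 'cV[R]_n -> 'M[C]_(p, q)) :
  smooth_mxC V A -> dirD v (fun y => - A y) x = - dirD v A x.
Proof.
move=> sA; rewrite -scaleN1r -dirDZ//; apply: dirD_congr => y _.
by rewrite scaleN1r.
Qed.

Lemma dirD_tr p q v (A : 'cV[R]_n -> 'M[C]_(p, q)) :
  dirD v (fun y => (A y)^T) x = (dirD v A x)^T.
Proof.
apply/matrixP => i j; rewrite !mxE; apply: eq_bigr => k _.
by congr (_ * _); apply: (pdC_congr oV k Vx) => y _; rewrite mxE.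
Qed.

Lemma dirD_conj p q v (A : 'cV[R]_n -> 'M[C]_(p, q)) : smooth_mxC V A ->
  dirD (map_mx conjc v) (fun y => map_mx conjc (A y)) x =
  map_mx conjc (dirD v A x).
Proof.
move=> sA; apply/matrixP => i j; rewrite !mxE rmorph_sum.
apply: eq_bigr => k _; rewrite rmorphM mxE; congr (_ * _).
rewrite -[RHS](pdC_conj oV k Vx (sA i j)).
by apply: (pdC_congr oV k Vx) => y _; rewrite mxE.
Qed.

Lemma jac_conj p (X : 'cV[R]_n -> 'cV[C]_p) : smooth_mxC V X ->
  jac (fun y => map_mx conjc (X y)) x = map_mx conjc (jac X x).
Proof.
move=> sX; apply/matrixP => i k; rewrite !mxE -(pdC_conj oV k Vx (sX i 0)).
by apply: (pdC_congr oV k Vx) => y _; rewrite mxE.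
Qed.

Lemma jacD p (X Y : 'cV[R]_n -> 'cV[C]_p) :
  smooth_mxC V X -> smooth_mxC V Y ->
  jac (fun y => X y + Y y) x = jac X x + jac Y x.
Proof.
move=> sX sY; apply/matrixP => i k.
rewrite !mxE -(pdCD oV k Vx (sX i 0) (sY i 0)).
by apply: (pdC_congr oV k Vx) => y _; rewrite mxE.
Qed.

End Point.

End MatrixCalculus.

(** * The Courant bracket *)

(* Matrix products and transposes arise with several convertible but distinct
   ring instances; folding them into [cmulmx] and [ctrmx] makes equal terms
   syntactically equal. *)
Definition cmulmx (K : comNzRingType) p q r (A : 'M[K]_(p, q))
  (B : 'M[K]_(q, r)) : 'M[K]_(p, r) := A *m B.
Definition ctrmx (K : comNzRingType) p q (A : 'M[K]_(p, q)) : 'M[K]_(q, p) :=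
  A^T.

(* Proves identities between linear combinations of matrices entrywise, the
   matrix products being atoms. *)
Ltac mxlin :=
  repeat match goal with
  | |- context [@mulmx ?K ?p ?q ?r ?A ?B] =>
      change (@mulmx K p q r A B) with (cmulmx A B)
  | |- context [@trmx ?K ?p ?q ?A] => change (@trmx K p q A) with (ctrmx A)
  end;
  repeat match goal with
  | |- context [@cmulmx ?R ?p ?q ?r ?A ?B] => generalize (@cmulmx R p q r A B)
  | |- context [@ctrmx ?R ?p ?q ?A] => generalize (@ctrmx R p q A)
  | |- context [@dirD ?R ?n ?p ?q ?v ?A ?x] => generalize (@dirD R n p q v A x)
  | |- context [@lie_bracket ?R ?n ?X ?Y ?x] =>
      generalize (@lie_bracket R n X Y x)
  end;
  intros; apply/matrixP => ? ?; rewrite ?mxE; ring.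

Section TransposeLinear.
Variables (K : pzRingType) (p q : nat).
Implicit Types A B : 'M[K]_(p, q).

Lemma trmxD A B : (A + B)^T = A^T + B^T. Proof. exact: raddfD. Qed.
Lemma trmxN A : (- A)^T = - A^T. Proof. exact: raddfN. Qed.
Lemma trmxZ a A : (a *: A)^T = a *: A^T. Proof. exact: linearZ. Qed.

End TransposeLinear.

Section ColumnPairing.
Variables (K : comNzRingType) (n : nat).
Implicit Types a b : 'cV[K]_n.

Lemma dotC a b : a^T *m b = b^T *m a.
Proof.
apply/matrixP => i j; rewrite !ord1 !mxE; apply: eq_bigr => k _.
by rewrite !mxE mulrC.
Qed.

Lemma dot_inj a b : (forall z : 'cV[K]_n, z^T *m a = z^T *m b) -> a = b.
Proof.
move=> ab; apply/row_matrixP => i; rewrite !rowE.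
by have := ab (delta_mx i 0); rewrite trmx_delta.
Qed.

Lemma dotM p (A : 'M[K]_(p, n)) (z : 'cV[K]_p) a :
  z^T *m (A *m a) = (A^T *m z)^T *m a.
Proof. by rewrite trmx_mul trmxK mulmxA. Qed.

End ColumnPairing.

Section Courant.
Variables (R : realType) (n : nat) (V : set 'cV[R]_n).
Hypothesis oV : open V.
Local Notation C := R[i].
Implicit Types X Y xi eta : 'cV[R]_n -> 'cV[C]_n.

(** The cotangent component of the bracket: the first two terms are L_X eta, and the antisymmetrized
    Jacobian of [xi] is d xi, contracted with Y. *)
Definition courant_form X xi Y eta (x : 'cV[R]_n) : 'cV[C]_n :=
  jac eta x *m X x + (jac X x)^T *m eta x
  - (jac xi x *m Y x - (jac xi x)^T *m Y x).

Lemma lie_bracketE X Y x :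
  lie_bracket X Y x = dirD (X x) Y x - dirD (Y x) X x.
Proof.
apply/matrixP => i j; rewrite !mxE !ord1 -sumrB.
by apply: eq_bigr => k _.
Qed.

Lemma courant_bracketE u v x :
  let X y := usubmx (u y) in let xi y := dsubmx (u y) in
  let Y y := usubmx (v y) in let eta y := dsubmx (v y) in
  courant_bracket (R := R) (n := n) u v x =
  col_mx (lie_bracket X Y x) (courant_form X xi Y eta x).
Proof.
move=> X xi Y eta; rewrite /courant_bracket -/X -/xi -/Y -/eta; congr col_mx.
apply/matrixP => i j; rewrite !mxE -big_split -sumrB -sumrB /=.
apply: eq_bigr => k _.
by rewrite ord1 !mxE /X /xi /Y /eta; ring.
Qed.

Lemma lie_bivectorE (Z : 'cV[R]_n -> 'cV[C]_n) (s : 'cV[R]_n -> 'M[C]_n) x :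
  lie_bivector Z s x =
  dirD (Z x) s x - jac Z x *m s x - s x *m (jac Z x)^T.
Proof.
apply/matrixP => i j; rewrite !mxE -!sumrB.
by apply: eq_bigr => k _; rewrite !mxE; ring.
Qed.

Section Point.
Variable x : 'cV[R]_n.
Hypothesis Vx : V x.

(** Testing against a constant vector turns transposed Jacobians into derivatives along [Z]; with
    [dot_inj] this is how covector identities are verified. *)
Lemma dot_courant_form X xi Y eta (Z : 'cV[C]_n) :
  Z^T *m courant_form X xi Y eta x =
  Z^T *m dirD (X x) eta x + (dirD Z X x)^T *m eta x
  - Z^T *m dirD (Y x) xi x + (dirD Z xi x)^T *m Y x.
Proof.
rewrite !dirD_jac !trmx_mul /courant_form !mulmxBr mulmxDr !mulmxA.
by mxlin.
Qed.

Lemma lie_bracketDl X1 X2 Y : smooth_mxC V X1 -> smooth_mxC V X2 ->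
  lie_bracket (fun y => X1 y + X2 y) Y x =
  lie_bracket X1 Y x + lie_bracket X2 Y x.
Proof.
move=> s1 s2; rewrite !lie_bracketE (dirDD oV Vx)// !dirD_jac mulmxDr.
by mxlin.
Qed.

Lemma lie_bracketC X Y : lie_bracket X Y x = - lie_bracket Y X x.
Proof. by rewrite !lie_bracketE opprB. Qed.

Lemma lie_bracketDr X Y1 Y2 : smooth_mxC V Y1 -> smooth_mxC V Y2 ->
  lie_bracket X (fun y => Y1 y + Y2 y) x =
  lie_bracket X Y1 x + lie_bracket X Y2 x.
Proof.
move=> s1 s2; rewrite lie_bracketC lie_bracketDl// opprD.
by rewrite -!(lie_bracketC X).
Qed.

Lemma courant_formDl X1 X2 xi1 xi2 Y eta :
  smooth_mxC V X1 -> smooth_mxC V X2 ->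
  smooth_mxC V xi1 -> smooth_mxC V xi2 ->
  courant_form (fun y => X1 y + X2 y) (fun y => xi1 y + xi2 y) Y eta x =
  courant_form X1 xi1 Y eta x + courant_form X2 xi2 Y eta x.
Proof.
move=> s1 s2 t1 t2; rewrite /courant_form !(jacD oV Vx)//.
rewrite !trmxD !mulmxDl !mulmxDr.
by mxlin.
Qed.

Lemma courant_formDr X xi Y1 Y2 eta1 eta2 :
  smooth_mxC V eta1 -> smooth_mxC V eta2 ->
  courant_form X xi (fun y => Y1 y + Y2 y) (fun y => eta1 y + eta2 y) x =
  courant_form X xi Y1 eta1 x + courant_form X xi Y2 eta2 x.
Proof.
move=> t1 t2; rewrite /courant_form !(jacD oV Vx)//.
rewrite !mulmxDl !mulmxDr.
by mxlin.
Qed.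

(* [u, v] + [v, u] = d<u, v>, which vanishes when u and v are orthogonal. *)
Lemma courant_formC X xi Y eta :
  smooth_mxC V X -> smooth_mxC V Y -> smooth_mxC V xi -> smooth_mxC V eta ->
  (forall y, V y -> (eta y)^T *m X y + (xi y)^T *m Y y = 0) ->
  courant_form Y eta X xi x = - courant_form X xi Y eta x.
Proof.
move=> sX sY sxi seta ort; apply: dot_inj => Z.
rewrite mulmxN !dot_courant_form.
have : dirD Z (fun y => (eta y)^T *m X y + (xi y)^T *m Y y) x = 0.
  by rewrite (dirD_congr oV Vx (B := fun=> 0) _ ort) dirD_cst.
have sT := smooth_mxC_tr oV.
rewrite (dirDD oV Vx); try by apply: smooth_mxCM => //; exact: sT.
rewrite !(dirDM oV Vx)//; try exact: sT.
rewrite !(dirD_tr oV Vx) (dotC (eta x)) (dotC (xi x)) => /eqP.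
rewrite addr_eq0 => /eqP e.
have -> : (dirD Z X x)^T *m eta x =
  - ((dirD Z xi x)^T *m Y x + (dirD Z Y x)^T *m xi x)
  - (dirD Z eta x)^T *m X x by rewrite -e; mxlin.
by mxlin.
Qed.

(** For skew [B] the cyclic sum is, up to sign, dB evaluated on [u], [v], [w]. *)
Definition closed_at (B : 'cV[R]_n -> 'M[C]_n) : Prop :=
  forall u v w : 'cV[C]_n, v^T *m dirD u B x *m w + w^T *m dirD v B x *m u +
                           u^T *m dirD w B x *m v = 0.

(** Gauge transformation by a closed 2-form preserves the Courant bracket; here it is applied to
    pure vector fields. *)
Lemma courant_form_graph (B : 'cV[R]_n -> 'M[C]_n) X Y :
  smooth_mxC V B -> smooth_mxC V X -> smooth_mxC V Y ->
  (forall y, V y -> (B y)^T = - B y) -> closed_at B ->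
  courant_form X (fun y => B y *m X y) Y (fun y => B y *m Y y) x =
  B x *m lie_bracket X Y x.
Proof.
move=> sB sX sY skB clB; apply: dot_inj => Z.
rewrite dot_courant_form lie_bracketE !(dirDM oV Vx)//.
have skdB v : (dirD v B x)^T = - dirD v B x.
  by rewrite -(dirD_tr oV Vx) (dirD_congr oV Vx _ skB) (dirDN oV Vx).
have e1 : (B x *m dirD Z X x)^T *m Y x = - ((dirD Z X x)^T *m (B x *m Y x)).
  by rewrite trmx_mul skB// mulmxN mulNmx mulmxA.
have e2 : (dirD Z B x *m X x)^T *m Y x = - ((X x)^T *m dirD Z B x *m Y x).
  by rewrite trmx_mul skdB mulmxN mulNmx.
have e3 : (Y x)^T *m dirD (X x) B x *m Z = - (Z^T *m (dirD (X x) B x *m Y x)).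
  by rewrite -mulmxA [LHS]dotC trmx_mul skdB mulmxN mulNmx mulmxA.
(* Closedness trades the derivative of [B] along the test vector for those along [X] and [Y], after
   which all derivatives of [B] cancel. *)
have := clB (X x) (Y x) Z; rewrite e3 -(mulmxA Z^T) => /eqP.
rewrite addrC addr_eq0 => /eqP e4.
rewrite trmxD mulmxDl e1 e2 e4 !(mulmxBr, mulmxDr).
by mxlin.
Qed.

End Point.
End Courant.

(** * Mixed brackets and holomorphic bivectors *)

Section Conjugation.
Variables (R : realType) (p q : nat).

Lemma conj_complexify (A : 'M[R]_(p, q)) :
  map_mx conjc (complexify A) = complexify A.
Proof. by apply/matrixP => i j; rewrite !mxE conjc_real. Qed.

Lemma conj_mxZ (a : R[i]) (A : 'M[R[i]]_(p, q)) :
  map_mx conjc (a *: A) = conjc a *: map_mx conjc A.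
Proof. exact: map_mxZ. Qed.

Lemma conj_mxK (A : 'M[R[i]]_(p, q)) : map_mx conjc (map_mx conjc A) = A.
Proof. by apply/matrixP => i j; rewrite !mxE conjcK. Qed.

Lemma conj_complexifyM r (A : 'M[R]_(p, q)) (B : 'M[R[i]]_(q, r)) :
  map_mx conjc (complexify A *m B) = complexify A *m map_mx conjc B.
Proof. by rewrite map_mxM conj_complexify. Qed.

Lemma complexifyM r (A : 'M[R]_(p, q)) (B : 'M[R]_(q, r)) :
  complexify (A *m B) = complexify A *m complexify B.
Proof. exact: map_mxM. Qed.

Lemma complexifyD (A B : 'M[R]_(p, q)) :
  complexify (A + B) = complexify A + complexify B.
Proof. exact: raddfD. Qed.

Lemma complexifyN (A : 'M[R]_(p, q)) : complexify (- A) = - complexify A.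
Proof. exact: raddfN. Qed.

Lemma complexify_tr (A : 'M[R]_(p, q)) : complexify A^T = (complexify A)^T.
Proof. by rewrite /complexify map_trmx. Qed.

End Conjugation.

Lemma complexify1 (R : realType) n : complexify (1%:M : 'M[R]_n) = 1%:M.
Proof. exact: map_mx1. Qed.

Section ImaginaryUnit.
Variable R : realType.
Local Notation ii := ('i%C : R[i]).

Lemma iiM : ii * ii = -1. Proof. by rewrite -expr2 sqr_i. Qed.

Lemma conjc_ii : conjc ii = - ii.
Proof. by apply/eqP; rewrite eq_complex /= oppr0 !eqxx. Qed.

Lemma ii_neq0 : ii != 0.
Proof. by rewrite eq_complex /= oner_eq0 andbF. Qed.

Lemma scale_ii p q (A : 'M[R[i]]_(p, q)) : ii *: (ii *: A) = - A.
Proof. by rewrite scalerA iiM scaleN1r. Qed.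

End ImaginaryUnit.

Lemma lie_bivector_conj (R : realType) (n : nat) (V : set 'cV[R]_n)
    (Z : 'cV[R]_n -> 'cV[R[i]]_n) (s : 'cV[R]_n -> 'M[R[i]]_n) x :
  open V -> V x -> smooth_mxC V Z -> smooth_mxC V s ->
  lie_bivector (fun y => map_mx conjc (Z y)) (fun y => map_mx conjc (s y)) x =
  map_mx conjc (lie_bivector Z s x).
Proof.
move=> oV Vx sZ ss; rewrite !lie_bivectorE !map_mxB !map_mxM -map_trmx.
by rewrite -(jac_conj oV Vx sZ) -(dirD_conj oV Vx).
Qed.

Section MixedBracket.
Variables (R : realType) (n : nat) (V : set 'cV[R]_n).
Variables J Q : 'cV[R]_n -> 'M[R]_n.
Local Notation C := R[i].
Local Notation ii := ('i%C : C).
Local Notation cJ x := (complexify (J x)).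
Local Notation cQ x := (complexify (Q x)).
Hypotheses (oV : open V) (sJ : smooth_mx V J) (sQ : smooth_mx V Q).
Hypothesis JJ : forall x, V x -> J x *m J x = - 1%:M.
Hypothesis JQ : forall x, V x -> J x *m Q x = Q x *m (J x)^T.
Hypothesis J_involutive : forall X Y : 'cV[R]_n -> 'cV[C]_n,
  smooth_mxC V X -> smooth_mxC V Y ->
  (forall x, V x -> T10 (J x) (X x) /\ T10 (J x) (Y x)) ->
  forall x, V x -> T10 (J x) (lie_bracket X Y x).
Hypothesis holo : forall Z : 'cV[R]_n -> 'cV[C]_n, smooth_mxC V Z ->
  (forall x, V x -> T01 (J x) (Z x)) -> forall x, V x -> forall a b : 'cV[C]_n,
  T10 (J x)^T a -> T10 (J x)^T b ->
  a^T *m lie_bivector Z (fun y => complexify (J y *m Q y) + ii *: cQ y) x *m b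
  = 0.

Lemma cJJ x (p : nat) (v : 'M[C]_(n, p)) : V x -> cJ x *m (cJ x *m v) = - v.
Proof.
move=> Vx; rewrite mulmxA -complexifyM JJ// complexifyN complexify1.
by rewrite mulNmx mul1mx.
Qed.

Lemma cJTJT x (p : nat) (v : 'M[C]_(n, p)) : V x ->
  (cJ x)^T *m ((cJ x)^T *m v) = - v.
Proof.
move=> Vx; rewrite mulmxA -trmx_mul -complexifyM JJ// complexifyN complexify1.
by rewrite trmxN trmx1 mulNmx mul1mx.
Qed.

Lemma cJQ x (p : nat) (v : 'M[C]_(n, p)) : V x ->
  cJ x *m (cQ x *m v) = cQ x *m ((cJ x)^T *m v).
Proof.
by move=> Vx; rewrite !mulmxA -complexify_tr -!complexifyM JQ.
Qed.

(** Moving [J] across the pairing multiplies the same number once by [ii] and once by [- ii]. *)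
Lemma dot_T01_T10 x (a v : 'cV[C]_n) : (cJ x)^T *m a = - (ii *: a) ->
  cJ x *m v = ii *: v -> a^T *m v = 0.
Proof.
move=> ha hv.
have : a^T *m (cJ x *m v) = ((cJ x)^T *m a)^T *m v by rewrite dotM.
rewrite ha hv trmxN trmxZ mulNmx -scalemxAr -scalemxAl => /eqP.
rewrite -addr_eq0 -scalerDl scaler_eq0 => /orP[/eqP h|/eqP//].
by move/eqP: h; rewrite -mulr2n mulrn_eq0 (negbTE (ii_neq0 R)).
Qed.

(** The conjugate of the holomorphic bivector; on T^*_{0,1} it is [- 2 ii Q]. *)
Let sb y : 'M[C]_n := complexify (J y *m Q y) - ii *: cQ y.

(** The complex conjugate of [holo]: the mixed bracket differentiates along T_{1,0}, whereas
    holomorphy is stated for derivatives along T_{0,1}. *)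
Lemma conj_lie_bivector X x : V x -> smooth_mxC V X ->
  (forall x, V x -> T10 (J x) (X x)) -> forall a b : 'cV[C]_n,
  (cJ x)^T *m a = - (ii *: a) -> (cJ x)^T *m b = - (ii *: b) ->
  a^T *m lie_bivector X sb x *m b = 0.
Proof.
move=> Vx sX TX a b Ta Tb.
have ssb : smooth_mxC V sb.
  apply: smooth_mxCD => //; last apply: smooth_mxCN => //;
    last apply: smooth_mxCZ => //;
    by apply: smooth_mxC_complexify => //; exact: smooth_mxM.
have conjT (c : 'cV[C]_n) : (cJ x)^T *m c = - (ii *: c) ->
    T10 (J x)^T (map_mx conjc c).
  move=> hc; rewrite /T10 /= -conj_complexifyM complexify_tr hc.
  by rewrite map_mxN conj_mxZ conjc_ii scaleNr opprK.
have TXb y : V y -> T01 (J y) (map_mx conjc (X y)).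
  move=> Vy; rewrite /T01 /= -conj_complexifyM (TX y Vy).
  by rewrite conj_mxZ conjc_ii scaleNr.
have sXb := smooth_mxC_conj oV sX.
have := holo sXb TXb Vx (conjT _ Ta) (conjT _ Tb).
have -> : (fun y => complexify (J y *m Q y) + ii *: cQ y) =
    (fun y => map_mx conjc (sb y)).
  apply/funext => y; rewrite /sb map_mxD map_mxN conj_mxZ !conj_complexify.
  by rewrite conjc_ii scaleNr opprK.
rewrite (lie_bivector_conj oV Vx sX ssb) map_trmx -!map_mxM => h.
by rewrite -[LHS]conj_mxK h map_mx0.
Qed.

Section Fields.
Variables X Y beta : 'cV[R]_n -> 'cV[C]_n.
Hypotheses (sX : smooth_mxC V X) (sY : smooth_mxC V Y).
Hypothesis sbeta : smooth_mxC V beta.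
Hypothesis TX : forall x, V x -> T10 (J x) (X x).
Hypothesis Tbeta : forall x, V x -> (cJ x)^T *m beta x = - (ii *: beta x).
Hypothesis JY :
  forall x, V x -> cJ x *m Y x = ii *: Y x + cQ x *m beta x.

Variable x : 'cV[R]_n.
Hypothesis Vx : V x.

(* The Lie derivative of [beta] along [X]. *)
Let gamma := jac beta x *m X x + (jac X x)^T *m beta x.

(** A covector lies in T^*_{0,1} when it kills T_{1,0}. For Z in T_{1,0}, gamma(Z) = X(beta(Z)) -
    beta([X, Z]), and both terms vanish, the second by involutivity. *)
Lemma lie_derivative_T01 : (cJ x)^T *m gamma = - (ii *: gamma).
Proof.
apply: dot_inj => z.
(* Up to a factor, [J + ii] projects onto T_{1,0}. Moved to the other side of the pairing, it also
   produces the eigenvalue equation for [gamma]. *)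
pose Z y := cJ y *m z + ii *: z.
have scJ := smooth_mxC_complexify oV sJ.
have sz : smooth_mxC V (fun=> z) by exact: smooth_mxC_cst.
have sZ : smooth_mxC V Z.
  by apply: smooth_mxCD => //; [exact: smooth_mxCM|exact: smooth_mxCZ].
have TZ y : V y -> T10 (J y) (Z y).
  move=> Vy; rewrite /T10 /= /Z mulmxDr cJJ// -scalemxAr scalerDr scale_ii.
  by rewrite addrC.
have := J_involutive sX sZ (fun y Vy => conj (TX Vy) (TZ y Vy)) Vx.
move=> /(dot_T01_T10 (Tbeta Vx)); rewrite lie_bracketE mulmxBr => /eqP.
rewrite subr_eq0 => /eqP e.
have : dirD (X x) (fun y => (beta y)^T *m Z y) x = 0.
  rewrite (dirD_congr oV Vx _ (B := fun=> 0)) ?dirD_cst// => y Vy.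
  exact: (dot_T01_T10 (Tbeta Vy) (TZ y Vy)).
rewrite (dirDM oV Vx)//; last exact: smooth_mxC_tr.
rewrite (dirD_tr oV Vx) e !dirD_jac [X in X + _]dotC [X in _ + X]mulmxA.
have -> : (beta x)^T *m jac X x *m Z x = (Z x)^T *m ((jac X x)^T *m beta x).
  by rewrite [RHS]dotC trmx_mul trmxK.
rewrite -mulmxDr -/gamma /Z trmxD trmxZ trmx_mul mulmxDl -mulmxA.
rewrite -scalemxAl mulmxN -scalemxAr => /eqP.
by rewrite addr_eq0 => /eqP.
Qed.

(** The relation [JY] passes from (Y, beta) to ([X, Y], gamma). Modulo T_{1,0}, Y is a multiple of
    [Q beta], so involutivity reduces the claim to [X, Q beta] = Q gamma modulo T_{1,0}, which is
    holomorphy of the bivector. *)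
Lemma lie_bracket_mixed :
  cJ x *m lie_bracket X Y x = ii *: lie_bracket X Y x + cQ x *m gamma.
Proof.
have scJ := smooth_mxC_complexify oV sJ.
have scQ := smooth_mxC_complexify oV sQ.
have ssb : smooth_mxC V sb.
  apply: smooth_mxCD => //; last apply: smooth_mxCN => //;
    last apply: smooth_mxCZ => //;
    by apply: smooth_mxC_complexify => //; exact: smooth_mxM.
(* [Q] maps T^*_{0,1} to T_{0,1}. *)
have JQT y (a : 'cV[C]_n) : V y -> (cJ y)^T *m a = - (ii *: a) ->
    cJ y *m (cQ y *m a) = - (ii *: (cQ y *m a)).
  by move=> Vy ha; rewrite cJQ// ha mulmxN -scalemxAr.
have sbT y (a : 'cV[C]_n) : V y -> (cJ y)^T *m a = - (ii *: a) ->
    sb y *m a = (- ii *+ 2) *: (cQ y *m a).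
  move=> Vy ha; rewrite /sb mulmxBl complexifyM -mulmxA JQT// -scalemxAl.
  by rewrite mulr2n scalerDl scaleNr.
pose QB y := cQ y *m beta y.
have sQB : smooth_mxC V QB by exact: smooth_mxCM.
pose P := lie_bracket X QB x.
pose D := P - cQ x *m gamma.
have JD : cJ x *m D = ii *: D.
  (* Up to a factor, [a] is the projection of [z] to T^*_{0,1}, and pairing it with [D] gives [z]
     paired with [J D - ii D]. *)
  apply: dot_inj => z; pose a : 'cV[C]_n := (cJ x)^T *m z - ii *: z.
  have Ta : (cJ x)^T *m a = - (ii *: a).
    rewrite /a mulmxBr cJTJT// -scalemxAr scalerBr scale_ii.
    by rewrite opprB.
  suff : a^T *m D = 0.
    rewrite /a trmxD trmxN trmxZ trmx_mul trmxK mulmxBl -mulmxA -scalemxAl.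
    by rewrite -scalemxAr => /eqP; rewrite subr_eq0 => /eqP.
  have := conj_lie_bivector Vx sX TX Ta (Tbeta Vx).
  (* The Leibniz rule for the Lie derivative of [sb beta], where [sb] acts on both [beta] and
     [gamma] as [- 2 ii Q]. *)
  rewrite -mulmxA; have -> : lie_bivector X sb x *m beta x = (- ii *+ 2) *: D.
    rewrite lie_bivectorE 2!mulmxBl.
    have e1 : dirD (X x) sb x *m beta x =
        (- ii *+ 2) *: dirD (X x) QB x - sb x *m dirD (X x) beta x.
      rewrite -(dirDZ oV Vx)//.
      rewrite -(dirD_congr oV Vx _ (A := fun y => sb y *m beta y)).
        by rewrite (dirDM oV Vx)// addrK.
      by move=> y Vy; rewrite sbT//; exact: Tbeta.
    have e2 : jac X x *m sb x *m beta x = (- ii *+ 2) *: dirD (QB x) X x.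
      by rewrite -mulmxA (sbT _ _ Vx (Tbeta Vx)) -scalemxAr dirD_jac.
    have e3 : sb x *m (jac X x)^T *m beta x =
        (- ii *+ 2) *: (cQ x *m gamma) - sb x *m dirD (X x) beta x.
      rewrite -(sbT _ _ Vx lie_derivative_T01) /gamma -dirD_jac mulmxDr mulmxA.
      by rewrite addrC addKr.
    rewrite e1 e2 e3 /D /P lie_bracketE !scalerBr opprB addrA.
    by mxlin.
  rewrite -scalemxAr => /eqP; rewrite scaler_eq0 mulrn_eq0 oppr_eq0.
  by rewrite (negbTE (ii_neq0 R)) /= => /eqP.
have cQg := JQT _ _ Vx lie_derivative_T01.
have JP : cJ x *m P = ii *: P - (ii *+ 2) *: (cQ x *m gamma).
  have -> : P = D + cQ x *m gamma by rewrite subrK.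
  rewrite mulmxDr JD cQg.
  by mxlin.
(* The multiple [2 ii] of the T_{1,0} part of [Y]: by [JY], the vector [J Y'] equals
   [2 ii (ii Y + Q beta) - ii Q beta], that is [ii Y']. *)
pose Y' y := (ii *+ 2) *: Y y + QB y.
have sY2 : smooth_mxC V (fun y => (ii *+ 2) *: Y y) by exact: smooth_mxCZ.
have sY' : smooth_mxC V Y' by exact: smooth_mxCD.
have TY' y : V y -> T10 (J y) (Y' y).
  move=> Vy; change (cJ y *m Y' y = ii *: Y' y).
  rewrite /Y' mulmxDr -scalemxAr (JY Vy) (JQT y _ Vy (Tbeta Vy)) -/(QB y).
  by mxlin.
have := J_involutive sX sY' (fun y Vy => conj (TX Vy) (TY' y Vy)) Vx.
rewrite /T10 /= (lie_bracketDr oV Vx)// -/P mulmxDr JP.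
have -> : lie_bracket X (fun y => (ii *+ 2) *: Y y) x =
    (ii *+ 2) *: lie_bracket X Y x.
  by rewrite !lie_bracketE (dirDZ oV Vx)// !dirD_jac -scalemxAr scalerBr.
rewrite -scalemxAr => e.
apply: (scalerI (a := ii *+ 2)).
  by rewrite mulrn_eq0 (negbTE (ii_neq0 R)).
move/(canRL (addrK _)): e => ->.
by mxlin.
Qed.

End Fields.
End MixedBracket.

(** * The splitting into [C_+] and [C_-] *)

Lemma posdef_unitmx (R : realFieldType) n (g : 'M[R]_n) :
  (forall X : 'cV[R]_n, X != 0 -> 0 < (X^T *m g *m X) 0 0) -> g \in unitmx.
Proof.
move=> gpos; rewrite -row_free_unit -kermx_eq0; apply: contraT => /rowV0Pn[v].
move=> /sub_kermxP vg v0; have := gpos v^T.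
by rewrite trmx_eq0 trmxK vg mul0mx mxE ltxx => /(_ v0).
Qed.

Lemma invmx_uniq (R : comUnitRingType) n (A B : 'M[R]_n) :
  A *m B = 1%:M -> invmx A = B.
Proof.
by move=> AB; have [uA _] := mulmx1_unit AB; rewrite -(mulKmx uA B) AB mulmx1.
Qed.

Definition diag_block (K : pzRingType) n (A B : 'M[K]_n) : 'M[K]_(n + n) :=
  block_mx A 0 0 B.

Lemma diag_blockM (K : pzRingType) n (A B A' B' : 'M[K]_n) :
  diag_block A B *m diag_block A' B' = diag_block (A *m A') (B *m B').
Proof.
by rewrite /diag_block mulmx_block !mul0mx !mulmx0 !addr0 !add0r.
Qed.

Lemma diag_block_col (K : pzRingType) n (A B : 'M[K]_n) p (a b : 'M[K]_(n, p)) :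
  diag_block A B *m col_mx a b = col_mx (A *m a) (B *m b).
Proof. by rewrite mul_block_col !mul0mx addr0 add0r. Qed.

Lemma diag_block_scalar (K : pzRingType) n (a : K) :
  diag_block (a%:M : 'M[K]_n) a%:M = a%:M.
Proof. by rewrite /diag_block -scalar_mx_block. Qed.

(** Below, [g] and [b] are specified through their doubles, so identities about them are proved
    after doubling. *)
Lemma double_inj (R : numFieldType) p q (A B : 'M[R]_(p, q)) :
  A + A = B + B -> A = B.
Proof.
move=> AB; apply: (scalerI (a := 2%:R)); first by rewrite pnatr_eq0.
by rewrite !scaler_nat !mulr2n.
Qed.

Lemma double_half (R : numFieldType) p q (A : 'M[R]_(p, q)) :
  2^-1 *: A + 2^-1 *: A = A.
Proof. by rewrite -scalerDl -[2^-1]div1r -splitr scale1r. Qed.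

Lemma half_double (R : numFieldType) p q (A : 'M[R]_(p, q)) :
  2^-1 *: (A + A) = A.
Proof. by rewrite scalerDr double_half. Qed.

Section Pointwise.
Variables (R : realType) (n : nat) (I J F : 'M[R]_n).
Hypotheses (II : I *m I = - 1%:M) (JJ : J *m J = - 1%:M).
Hypotheses (FT : F^T = - F) (FJ : F *m J + I^T *m F = 0).

Variables g b : 'M[R]_n.
Hypothesis gE : g + g = - (F *m I) - F *m J.
Hypothesis bE : b + b = F *m I - F *m J.

(* The columns are the lifts [X + (b + g) X] and [X + (b - g) X] of T to
   [C_+] and [C_-]; here [b + g = - F J] and [b - g = F I]. *)
Definition frame : 'M[R]_(n + n) :=
  block_mx 1%:M 1%:M (- (F *m J)) (F *m I).

Lemma tr_IF : I^T *m F = - (F *m J).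
Proof. by apply/eqP; rewrite -addr_eq0 addrC FJ. Qed.

(** Transposing the compatibility relation of [F] exchanges the roles of [I] and [J], since [F] is
    skew. *)
Lemma tr_JF : J^T *m F = - (F *m I).
Proof.
have := congr1 trmx tr_IF; rewrite trmxN !trmx_mul trmxK FT mulNmx mulmxN.
by rewrite opprK => <-.
Qed.

Lemma b_add_g : b + g = - (F *m J).
Proof. by apply: double_inj; rewrite addrACA bE gE; mxlin. Qed.

Lemma b_sub_g : b - g = F *m I.
Proof. by apply: double_inj; rewrite addrACA bE -opprD gE; mxlin. Qed.

Lemma b_tr : b^T = - b.
Proof.
apply: double_inj; rewrite -trmxD -opprD bE trmxD !trmxN !trmx_mul FT !mulmxN.
by rewrite tr_IF tr_JF; mxlin.
Qed.

(** Conjugation by [I] swaps the two summands [F I] and [F J] of [- 2 g]. *)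
Lemma metric_I : I^T *m g *m I = g.
Proof.
have h1 : I^T *m (F *m I) *m I = F *m J.
  by rewrite mulmxA tr_IF !mulNmx -!mulmxA II !mulmxN mulmx1 opprK.
have h2 : I^T *m (F *m J) *m I = F *m I.
  by rewrite mulmxA tr_IF !mulNmx -(mulmxA F) JJ mulmxN mulmx1 mulNmx opprK.
apply: double_inj; rewrite -mulmxDl -mulmxDr gE mulmxBr mulmxN.
by rewrite mulmxBl mulNmx h1 h2; mxlin.
Qed.

Lemma metric_J : J^T *m g *m J = g.
Proof.
have h1 : J^T *m (F *m J) *m J = F *m I.
  by rewrite mulmxA tr_JF !mulNmx -!mulmxA JJ !mulmxN mulmx1 opprK.
have h2 : J^T *m (F *m I) *m J = F *m J.
  by rewrite mulmxA tr_JF !mulNmx -(mulmxA F) II mulmxN mulmx1 mulNmx opprK.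
apply: double_inj; rewrite -mulmxDl -mulmxDr gE mulmxBr mulmxN.
by rewrite mulmxBl mulNmx h1 h2; mxlin.
Qed.

Hypothesis gpos : forall X : 'cV[R]_n, X != 0 -> 0 < (X^T *m g *m X) 0 0.

Lemma metric_unit : g \in unitmx. Proof. exact: posdef_unitmx. Qed.

(** [F] is a left factor of the invertible matrix [g]. *)
Lemma form_unit : F \in unitmx.
Proof.
have := metric_unit; have -> : g = F *m (- (2^-1 *: (I + J))).
  by apply: double_inj; rewrite gE mulmxN -!opprD -!mulmxDr double_half.
by rewrite unitmx_mul => /andP[].
Qed.

Lemma frame_unit : frame \in unitmx.
Proof.
have [k gk] : exists k, g *m k = 1%:M.
  by exists (invmx g); rewrite mulmxV// metric_unit.
have [t gt] : exists t, g *m t = b.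
  by exists (k *m b); rewrite mulmxA gk mul1mx.
(* The inverse solves X1 + X2 = X and b X + g (X1 - X2) = xi, so that X1 - X2 = k xi - t X. *)
suff /mulmx1_unit[] : frame *m (2^-1 *: block_mx (1%:M - t) k (1%:M + t) (- k))
  = 1%:M by [].
have -> : 1%:M =
    2^-1 *: block_mx (2%:R *: 1%:M) 0 0 (2%:R *: 1%:M) :> 'M[R]_(n + n).
  rewrite scale_block_mx !scalerA mulVf ?pnatr_eq0// !scaler0 !scale1r.
  by rewrite -scalar_mx_block.
rewrite -scalemxAr; congr (_ *: _).
rewrite /frame -b_add_g -b_sub_g mulmx_block !mul1mx.
rewrite !(mulmxDl, mulmxDr) !mulmxN !mulNmx !mulmx1 gt gk.
by congr block_mx; mxlin.
Qed.

Let mB : 'M[R]_(n + n) :=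
  2^-1 *: (block_mx 1%:M 0 b 1%:M *m
    block_mx (J + I) (- (invmx (g *m J) - invmx (g *m I)))
             (g *m J - g *m I) (- (J^T + I^T)) *m
    block_mx 1%:M 0 (- b) 1%:M).
Let mA : 'M[R]_(n + n) :=
  2^-1 *: (block_mx 1%:M 0 b 1%:M *m
    block_mx (J - I) (- (invmx (g *m J) + invmx (g *m I)))
             (g *m J + g *m I) (- (J^T - I^T)) *m
    block_mx 1%:M 0 (- b) 1%:M).

(** The gauged frame has lower blocks [g] and [- g], so the inverse forms always meet a factor [g]
    and are eliminated by this identity. *)
Lemma invmx_omega (E : 'M[R]_n) : E *m E = - 1%:M ->
  invmx (g *m E) *m g = - E.
Proof.
move=> EE; have -> : invmx (g *m E) = - (E *m invmx g).
  apply: invmx_uniq; rewrite mulmxN mulmxA -(mulmxA g) EE mulmxN mulmx1.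
  by rewrite mulNmx opprK mulmxV// metric_unit.
by rewrite mulNmx mulmxKV// metric_unit.
Qed.

Lemma tr_metric (E : 'M[R]_n) : E *m E = - 1%:M -> E^T *m g *m E = g ->
  E^T *m g = - (g *m E).
Proof.
move=> EE Eg; rewrite -[in RHS]Eg -!mulmxA EE !mulmxN mulmx1.
by rewrite opprK.
Qed.

Lemma frame_gauge : block_mx 1%:M 0 (- b) 1%:M *m frame =
  block_mx 1%:M 1%:M g (- g).
Proof.
rewrite /frame -b_add_g -b_sub_g mulmx_block.
rewrite !mul1mx !mul0mx !mulmx1 !addr0.
by congr block_mx; mxlin.
Qed.

(** Doubled blocks absorb the factor 1/2 of the structures, so each of [JB_frame] and [JA_frame]
    becomes a comparison of four blocks. *)
Lemma gauge_col (P N : 'M[R]_n) : 2^-1 *: (block_mx 1%:M 0 b 1%:M *m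
    block_mx (P + P) (N + N) (g *m P + g *m P)
             (- (g *m N + g *m N))) =
  frame *m diag_block P N.
Proof.
rewrite /frame -b_add_g -b_sub_g !mulmx_block.
rewrite !mul1mx !mul0mx !mulmx0 !addr0 !add0r scale_block_mx.
congr block_mx; rewrite ?half_double//.
  by rewrite mulmxDr addrACA half_double mulmxDl.
by rewrite mulmxDr opprD addrACA half_double mulmxBl.
Qed.

Lemma JB_frame : mB *m frame = frame *m diag_block J I.
Proof.
rewrite /mB -scalemxAl -mulmxA frame_gauge -gauge_col -mulmxA.
congr (_ *: (_ *m _)); rewrite mulmx_block !mulmx1 !mulNmx !mulmxN.
rewrite !mulmxBl !mulmxDl (invmx_omega II) (invmx_omega JJ).
rewrite (tr_metric II metric_I) (tr_metric JJ metric_J).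
by congr block_mx; mxlin.
Qed.

Lemma JA_frame : mA *m frame = frame *m diag_block J (- I).
Proof.
rewrite /mA -scalemxAl -mulmxA frame_gauge -gauge_col -mulmxA.
congr (_ *: (_ *m _)); rewrite mulmx_block !mulmx1 !mulNmx !mulmxN.
rewrite !mulmxBl !mulmxDl (invmx_omega II) (invmx_omega JJ).
rewrite (tr_metric II metric_I) (tr_metric JJ metric_J).
by congr block_mx; mxlin.
Qed.

(** Both sides act on the invertible frame as [J] and [- I]. *)
Lemma JA_symplectic : mA = block_mx 0 (- invmx F) F 0.
Proof.
rewrite -[LHS](mulmxK frame_unit) JA_frame; apply: (canLR (mulmxK frame_unit)).
rewrite /frame /diag_block !mulmx_block !mul1mx !mul0mx !mulmx0 !mulmx1.
rewrite !addr0 !add0r !mulNmx !mulmxN opprK !mulKmx ?form_unit//.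
by rewrite -!mulmxA II JJ !mulmxN !mulmx1 !opprK.
Qed.

(** For graphs of [B] and [B'] the pairing has matrix [B^T + B']. As [b] is skew and [g] symmetric,
    this is [2 g] on C_+, [- 2 g] on C_-, and 0 between them. *)
Lemma pairing_frame (x y x' y' : 'cV[R]_n) :
  pairing (frame *m col_mx x y) (frame *m col_mx x' y') =
  2 * ((x^T *m g *m x') 0 0 - (y^T *m g *m y') 0 0).
Proof.
rewrite /pairing /frame !mul_block_col !col_mxKu !col_mxKd !mul1mx.
transitivity ((2 *: (x^T *m g *m x' - y^T *m g *m y')) 0 0).
  2: by rewrite !mxE.
congr (fun_of_matrix _ 0 0).
have dbl (a c : 'cV[R]_n) : 2 *: (a^T *m g *m c) =
    - (a^T *m (F *m I *m c)) - a^T *m (F *m J *m c).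
  rewrite scaler_nat mulr2n -mulmxDl -mulmxDr gE mulmxBr mulmxN mulmxBl.
  by rewrite mulNmx -!mulmxA.
have trI (a c : 'cV[R]_n) : (F *m I *m a)^T *m c = a^T *m (F *m J *m c).
  by rewrite 2!trmx_mul FT mulmxN tr_IF opprK -!mulmxA.
have trJ (a c : 'cV[R]_n) : (F *m J *m a)^T *m c = a^T *m (F *m I *m c).
  by rewrite 2!trmx_mul FT mulmxN tr_JF opprK -!mulmxA.
rewrite scalerBr !dbl !mulNmx !trmxD !trmxN !mulmxDl !mulmxDr !mulNmx.
rewrite !(dotC (F *m J *m x')) !(dotC (F *m I *m y')) !trI !trJ.
by mxlin.
Qed.

End Pointwise.

(** * Involutivity of the eigenbundles *)

Lemma sum3_rot (K : nmodType) n (G : 'I_n -> 'I_n -> 'I_n -> K) :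
  \sum_j \sum_k \sum_i G i j k = \sum_i \sum_j \sum_k G i j k.
Proof.
rewrite [RHS]exchange_big; apply: eq_bigr => j _.
exact: exchange_big.
Qed.

Section Involutivity.
Variables (R : realType) (n : nat) (V : set 'cV[R]_n).
Hypothesis oV : open V.
Local Notation C := R[i].
Local Notation ii := ('i%C : C).

Section Congruence.
Variable x : 'cV[R]_n.
Hypothesis Vx : V x.

Lemma jac_congr p (X Y : 'cV[R]_n -> 'cV[C]_p) :
  (forall y, V y -> X y = Y y) -> jac X x = jac Y x.
Proof.
move=> XY; apply/matrixP => i k; rewrite !mxE.
by apply: (pdC_congr oV k Vx) => y Vy; rewrite XY.
Qed.

Lemma jacZ p (a : C) (X : 'cV[R]_n -> 'cV[C]_p) : smooth_mxC V X ->
  jac (fun y => a *: X y) x = a *: jac X x.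
Proof.
move=> sX; apply/matrixP => i k; rewrite !mxE.
transitivity (pdC k (fun y => a * X y i 0) x).
  by apply: (pdC_congr oV k Vx) => y _; rewrite mxE.
by rewrite (pdCM oV k Vx (smoothC_cst V a) (sX i 0)) pdC_cst mul0r add0r.
Qed.

Lemma lie_bracket_congr (X X' Y Y' : 'cV[R]_n -> 'cV[C]_n) :
  (forall y, V y -> X y = X' y) -> (forall y, V y -> Y y = Y' y) ->
  lie_bracket X Y x = lie_bracket X' Y' x.
Proof.
move=> XX YY; rewrite !lie_bracketE !dirD_jac (jac_congr XX) (jac_congr YY).
by rewrite XX ?YY.
Qed.

Lemma courant_form_congr (X X' xi xi' Y Y' eta eta' : 'cV[R]_n -> 'cV[C]_n) :
  (forall y, V y -> X y = X' y) -> (forall y, V y -> xi y = xi' y) ->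
  (forall y, V y -> Y y = Y' y) -> (forall y, V y -> eta y = eta' y) ->
  courant_form X xi Y eta x = courant_form X' xi' Y' eta' x.
Proof.
move=> XX xx YY ee; rewrite /courant_form (jac_congr XX) (jac_congr xx).
by rewrite (jac_congr ee) XX// YY// ee.
Qed.

Lemma closed_complexify (F : 'cV[R]_n -> 'M[R]_n) :
  (forall i j k : 'I_n, pd i (fun y => F y j k) x + pd j (fun y => F y k i) x +
    pd k (fun y => F y i j) x = 0) ->
  closed_at x (fun y => complexify (F y)).
Proof.
move=> clF u v w; set B := fun y => complexify (F y).
pose T i j k : C := real_complex R (pd i (fun y => F y j k) x).
have dE (a b c : 'cV[C]_n) : (b^T *m dirD a B x *m c) 0 0 =
    \sum_i \sum_j \sum_k a i 0 * b j 0 * c k 0 * T i j k.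
  rewrite -mulmxA !mxE.
  transitivity (\sum_j \sum_k \sum_i a i 0 * b j 0 * c k 0 * T i j k).
    apply: eq_bigr => j _; rewrite !mxE mulr_sumr; apply: eq_bigr => k _.
    rewrite !mxE mulr_suml mulr_sumr; apply: eq_bigr => i _.
    have -> : pdC i (fun y => B y j k) x = T i j k.
      rewrite -[RHS]pdC_real; apply: (pdC_congr oV i Vx) => y _.
      by rewrite mxE.
    by ring.
  exact: (sum3_rot (fun i j k => a i 0 * b j 0 * c k 0 * T i j k)).
have aE (A A' : 'rV[C]_1) : (A + A') 0 0 = A 0 0 + A' 0 0 by exact: mxE.
apply/matrixP => p q; rewrite !ord1 2!aE [RHS]mxE !dE.
(* Cyclic renaming of the indices gives the three sums the common coefficient [u_i v_j w_k]. *)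
rewrite -[X in X + _ + _]sum3_rot -[X in _ + X]sum3_rot -[X in _ + X]sum3_rot.
rewrite -!big_split /=; apply: big1 => j _.
rewrite -!big_split /=; apply: big1 => k _.
rewrite -!big_split /=; apply: big1 => i _.
transitivity (u i 0 * v j 0 * w k 0 * (T i j k + T j k i + T k i j)).
  by ring.
by rewrite /T -!rmorphD clF rmorph0 mulr0.
Qed.

End Congruence.

Lemma closed_atZ (B : 'cV[R]_n -> 'M[C]_n) (a : C) x : V x -> smooth_mxC V B ->
  closed_at x B -> closed_at x (fun y => a *: B y).
Proof.
move=> Vx sB clB u v w; rewrite !(dirDZ oV Vx _ _ sB).
have aE (b d : 'cV[C]_n) (D : 'M[C]_n) :
  b^T *m (a *: D) *m d = a *: (b^T *m D *m d) by rewrite -scalemxAr -scalemxAl.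
by rewrite !aE -!scalerDr (clB u v w) scaler0.
Qed.

Lemma skew_complexify (A : 'M[R]_n) (a : C) : A^T = - A ->
  (a *: complexify A)^T = - (a *: complexify A).
Proof. by move=> AT; rewrite trmxZ -complexify_tr AT complexifyN; mxlin. Qed.

Lemma complexify_block m1 m2 n1 n2 (A : 'M[R]_(m1, n1)) (B : 'M[R]_(m1, n2))
    (A' : 'M[R]_(m2, n1)) (B' : 'M[R]_(m2, n2)) :
  complexify (block_mx A B A' B') =
  block_mx (complexify A) (complexify B) (complexify A') (complexify B').
Proof. exact: map_block_mx. Qed.

Lemma complexify0 p q : complexify (0 : 'M[R]_(p, q)) = 0.
Proof. exact: map_mx0. Qed.

Lemma complexify_unit m (A : 'M[R]_m) : A \in unitmx ->
  complexify A \in unitmx.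
Proof. by move=> uA; rewrite /complexify map_unitmx. Qed.

(** * The [+i]-eigenbundle of [J_A], a graph over T *)

Section Symplectic.
Variable F : 'cV[R]_n -> 'M[R]_n.
Hypothesis sF : smooth_mx V F.
Hypothesis FT : forall x, V x -> (F x)^T = - F x.
Hypothesis uF : forall x, V x -> F x \in unitmx.
Hypothesis clF : forall x, V x -> forall i j k : 'I_n,
  pd i (fun y => F y j k) x + pd j (fun y => F y k i) x +
  pd k (fun y => F y i j) x = 0.

Lemma eigen_symplectic x (X xi : 'cV[C]_n) : V x ->
  eigen_i (block_mx 0 (- invmx (F x)) (F x) 0) (col_mx X xi) <->
  xi = (- ii *: complexify (F x)) *m X.
Proof.
move=> Vx; have uc := complexify_unit (uF Vx).
rewrite /eigen_i /= complexify_block complexify0 complexifyN.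
rewrite {1}/complexify map_invmx -/(complexify (F x)).
rewrite mul_block_col !mul0mx add0r addr0 scale_col_mx mulNmx -scalemxAl.
split=> [/eq_col_mx[_ ->]|->].
  by rewrite scalerA mulNr iiM opprK scale1r.
by rewrite -scalemxAr mulKmx// -scaleNr opprK scalerA mulrN iiM opprK scale1r.
Qed.

Lemma symplectic_involutive (u v : 'cV[R]_n -> 'cV[C]_(n + n)) :
  smooth_mxC V u -> smooth_mxC V v ->
  (forall x, V x -> eigen_i (block_mx 0 (- invmx (F x)) (F x) 0) (u x) /\
                    eigen_i (block_mx 0 (- invmx (F x)) (F x) 0) (v x)) ->
  forall x, V x -> eigen_i (block_mx 0 (- invmx (F x)) (F x) 0)
                           (courant_bracket u v x).
Proof.
move=> su sv Euv x Vx; rewrite courant_bracketE; apply/eigen_symplectic => //.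
pose B y := - ii *: complexify (F y).
have sB : smooth_mxC V B.
  by apply: smooth_mxCZ => //; exact: smooth_mxC_complexify.
have dE w y : V y -> eigen_i (block_mx 0 (- invmx (F y)) (F y) 0) (w y) ->
    dsubmx (w y) = B y *m usubmx (w y) :> 'cV[C]_n.
  by move=> Vy; rewrite -{1}[w y]vsubmxK => /eigen_symplectic; apply.
rewrite -(courant_form_graph oV Vx sB); first last.
- apply: closed_atZ => //; first exact: smooth_mxC_complexify.
  exact: closed_complexify (clF Vx).
- by move=> y Vy; exact: skew_complexify (FT Vy).
- exact: smooth_mxC_usub.
- exact: smooth_mxC_usub.
by apply: (courant_form_congr Vx) => // y Vy; apply: dE => //;
  have [] := Euv y Vy.
Qed.

End Symplectic.

Lemma eigen_iD m (A : 'M[R]_m) (u v : 'cV[C]_m) :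
  eigen_i A u -> eigen_i A v -> eigen_i A (u + v).
Proof. by rewrite /eigen_i /= mulmxDr scalerDr => -> ->. Qed.

Lemma eigen_iN m (A : 'M[R]_m) (u : 'cV[C]_m) : eigen_i A u -> eigen_i A (- u).
Proof. by rewrite /eigen_i /= mulmxN scalerN => ->. Qed.

Lemma eigen_conj m (A S D : 'M[R]_m) (w : 'cV[C]_m) : S \in unitmx ->
  A *m S = S *m D ->
  eigen_i A (complexify S *m w) <-> complexify D *m w = ii *: w.
Proof.
move=> uS AS; rewrite /eigen_i /= mulmxA -complexifyM AS complexifyM -mulmxA.
rewrite scalemxAr; split=> [|->//].
exact: (can_inj (mulKmx (complexify_unit uS))).
Qed.

(** * The [+i]-eigenbundle of [J_B], a sum of two graphs *)

Section Mixed.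
Variables I J Q F : 'cV[R]_n -> 'M[R]_n.
Variable JB : 'cV[R]_n -> 'M[R]_(n + n).
Local Notation S x := (frame (I x) (J x) (F x)).
Local Notation cF x := (complexify (F x)).
Hypotheses (sI : smooth_mx V I) (sJ : smooth_mx V J).
Hypotheses (sQ : smooth_mx V Q) (sF : smooth_mx V F).
Hypothesis JJ : forall x, V x -> J x *m J x = - 1%:M.
Hypothesis JQ : forall x, V x -> J x *m Q x = Q x *m (J x)^T.
Hypothesis JI : forall x, V x -> J x - I x = Q x *m F x.
Hypothesis FJ : forall x, V x -> F x *m J x + (I x)^T *m F x = 0.
Hypothesis FT : forall x, V x -> (F x)^T = - F x.
Hypothesis uF : forall x, V x -> F x \in unitmx.
Hypothesis uS : forall x, V x -> S x \in unitmx.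
Hypothesis JBS : forall x, V x -> JB x *m S x = S x *m diag_block (J x) (I x).
Hypothesis clF : forall x, V x -> forall i j k : 'I_n,
  pd i (fun y => F y j k) x + pd j (fun y => F y k i) x +
  pd k (fun y => F y i j) x = 0.
Hypothesis I_involutive : forall X Y : 'cV[R]_n -> 'cV[C]_n,
  smooth_mxC V X -> smooth_mxC V Y ->
  (forall x, V x -> T10 (I x) (X x) /\ T10 (I x) (Y x)) ->
  forall x, V x -> T10 (I x) (lie_bracket X Y x).
Hypothesis J_involutive : forall X Y : 'cV[R]_n -> 'cV[C]_n,
  smooth_mxC V X -> smooth_mxC V Y ->
  (forall x, V x -> T10 (J x) (X x) /\ T10 (J x) (Y x)) ->
  forall x, V x -> T10 (J x) (lie_bracket X Y x).
Hypothesis holo : forall Z : 'cV[R]_n -> 'cV[C]_n, smooth_mxC V Z ->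
  (forall x, V x -> T01 (J x) (Z x)) -> forall x, V x -> forall a b : 'cV[C]_n,
  T10 (J x)^T a -> T10 (J x)^T b ->
  a^T *m lie_bivector Z
    (fun y => complexify (J y *m Q y) + ii *: complexify (Q y)) x *m b = 0.

Let B y : 'M[C]_n := - ii *: cF y.
Let B' y : 'M[C]_n := ii *: cF y.

(** On eigenvectors the lifts [- F J] and [F I] become [- ii F] and [ii F], constant multiples of a
    closed form; this is where closedness of [F] becomes usable. *)
Lemma frame_col x (X1 X2 : 'cV[C]_n) : T10 (J x) X1 -> T10 (I x) X2 ->
  complexify (S x) *m col_mx X1 X2 =
  col_mx (X1 + X2) (B x *m X1 + B' x *m X2).
Proof.
move=> T1 T2; rewrite complexify_block !complexify1 complexifyN !complexifyM.
rewrite mul_block_col !mul1mx mulNmx -!mulmxA T1 T2 -!scalemxAr /B /B'.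
by rewrite -!scalemxAl scaleNr.
Qed.

Lemma eigen_JB x (X1 X2 : 'cV[C]_n) : V x -> T10 (J x) X1 -> T10 (I x) X2 ->
  eigen_i (JB x) (col_mx (X1 + X2) (B x *m X1 + B' x *m X2)).
Proof.
move=> Vx T1 T2; rewrite -frame_col//; apply/(eigen_conj _ (uS Vx) (JBS Vx)).
rewrite complexify_block !complexify0 diag_block_col scale_col_mx.
by rewrite T1 T2.
Qed.

Lemma eigen_JB_plus x (X : 'cV[C]_n) : V x -> T10 (J x) X ->
  eigen_i (JB x) (col_mx X (B x *m X)).
Proof.
move=> Vx TX; have T0 : T10 (I x) 0 by rewrite /T10 /= mulmx0 scaler0.
by have := eigen_JB Vx TX T0; rewrite mulmx0 !addr0.
Qed.

Lemma eigen_JB_minus x (X : 'cV[C]_n) : V x -> T10 (I x) X ->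
  eigen_i (JB x) (col_mx X (B' x *m X)).
Proof.
move=> Vx TX; have T0 : T10 (J x) 0 by rewrite /T10 /= mulmx0 scaler0.
by have := eigen_JB Vx T0 TX; rewrite mulmx0 !add0r.
Qed.

Lemma eigen_JB_split x (u : 'cV[C]_(n + n)) : V x -> eigen_i (JB x) u ->
  let w := invmx (complexify (S x)) *m u in
  T10 (J x) (usubmx w) /\ T10 (I x) (dsubmx w).
Proof.
move=> Vx Eu w; have uc := complexify_unit (uS Vx).
have : eigen_i (JB x) (complexify (S x) *m w) by rewrite /w mulKVmx.
move=> /(eigen_conj _ (uS Vx) (JBS Vx)).
rewrite -{1}[w]vsubmxK complexify_block !complexify0 diag_block_col.
rewrite -[in RHS](vsubmxK w) scale_col_mx => /eq_col_mx[h1 h2].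
by split.
Qed.

(** [F] carries T_{1,0} of [I] into T^*_{0,1} of [J], because [J^T F = - F I]. *)
Lemma tr_JcF x (X : 'cV[C]_n) : V x -> T10 (I x) X ->
  (complexify (J x))^T *m (cF x *m X) = - (ii *: (cF x *m X)).
Proof.
move=> Vx TX; rewrite mulmxA -complexify_tr -complexifyM.
rewrite (tr_JF (FT Vx) (FJ Vx)) complexifyN complexifyM mulNmx -mulmxA TX.
by rewrite -scalemxAr.
Qed.

Section Sections.
Variables X Y : 'cV[R]_n -> 'cV[C]_n.
Hypotheses (sX : smooth_mxC V X) (sY : smooth_mxC V Y).
Hypothesis TX : forall y, V y -> T10 (J y) (X y).
Hypothesis TY : forall y, V y -> T10 (I y) (Y y).
Variable x : 'cV[R]_n.
Hypothesis Vx : V x.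

Let scF : smooth_mxC V (fun y => cF y).
Proof. exact: smooth_mxC_complexify. Qed.
Let sB : smooth_mxC V B. Proof. exact: smooth_mxCZ. Qed.
Let sB' : smooth_mxC V B'. Proof. exact: smooth_mxCZ. Qed.
Let skB y : V y -> (B y)^T = - B y.
Proof. by move=> Vy; exact: skew_complexify (FT Vy). Qed.
Let clB : closed_at x B.
Proof. by apply: closed_atZ => //; exact: closed_complexify (clF Vx). Qed.

(* Subtracting the closed graph of [B] leaves the bracket of [X] with
   [Y + 2 i F Y], which is handled by the holomorphic Poisson structure
   of [J]. *)
Lemma eigen_mixed : eigen_i (JB x) (col_mx (lie_bracket X Y x)
  (courant_form X (fun y => B y *m X y) Y (fun y => B' y *m Y y) x)).
Proof.
pose beta y := cF y *m Y y.
have sbeta : smooth_mxC V beta by exact: smooth_mxCM.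
pose gamma := jac beta x *m X x + (jac X x)^T *m beta x.
have Tbeta y : V y -> (complexify (J y))^T *m beta y = - (ii *: beta y).
  by move=> Vy; exact: tr_JcF (TY Vy).
have JY y : V y ->
    complexify (J y) *m Y y = ii *: Y y + complexify (Q y) *m beta y.
  move=> Vy; rewrite /beta mulmxA -complexifyM -(JI Vy) complexifyD complexifyN.
  by rewrite mulmxBl (TY Vy) addrC subrK.
have Tg := lie_derivative_T01 oV sJ JJ J_involutive sX sbeta TX Tbeta Vx.
have JL := lie_bracket_mixed oV sJ sQ JJ JQ J_involutive holo sX sY sbeta TX
  Tbeta JY Vx.
rewrite -/gamma in Tg JL.
(* As [B' - B = 2 ii F], the covector [2 ii gamma] left by the gauge transformation dictates the
   component along the graph of [B']. *)
pose Z2 := invmx (cF x) *m gamma.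
have FZ2 : cF x *m Z2 = gamma by rewrite mulKVmx// complexify_unit// uF.
have T2 : T10 (I x) Z2.
  apply: (can_inj (mulKmx (complexify_unit (uF Vx)))).
  rewrite -scalemxAr FZ2 mulmxA -complexifyM -[F x *m I x]opprK.
  rewrite -(tr_JF (FT Vx) (FJ Vx)) complexifyN complexifyM complexify_tr mulNmx.
  by rewrite -mulmxA FZ2 Tg opprK.
have JZ2 : complexify (J x) *m Z2 = ii *: Z2 + complexify (Q x) *m gamma.
  rewrite -FZ2 mulmxA -complexifyM -(JI Vx) complexifyD complexifyN mulmxBl.
  by rewrite (T2 : _ = _) addrC subrK.
pose Z1 := lie_bracket X Y x - Z2.
(* The bracket and [Z2] have the same image [Q gamma] under [J - ii], so their difference is an
   eigenvector. *)
have T1 : T10 (J x) Z1.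
  rewrite /T10 /= /Z1 mulmxBr JL JZ2 scalerBr opprD addrACA subrr addr0.
  by [].
have -> : lie_bracket X Y x = Z1 + Z2 by rewrite subrK.
suff -> : courant_form X (fun y => B y *m X y) Y (fun y => B' y *m Y y) x =
    B x *m Z1 + B' x *m Z2 by exact: eigen_JB.
have -> : B x *m Z1 + B' x *m Z2 =
    B x *m lie_bracket X Y x + (ii *+ 2) *: gamma.
  rewrite /B /B' /Z1 mulmxBr -!scalemxAl FZ2.
  by mxlin.
rewrite -(courant_form_graph oV Vx sB sX sY skB clB).
have s2b : smooth_mxC V (fun y => (ii *+ 2) *: beta y) by exact: smooth_mxCZ.
(* The bracket with a pure covector field is its Lie derivative along [X]. *)
have -> : (ii *+ 2) *: gamma = courant_form X (fun y => B y *m X y) (fun=> 0)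
    (fun y => (ii *+ 2) *: beta y) x.
  rewrite /courant_form !mulmx0 subrr subr0 (jacZ Vx)// /gamma scalerDr.
  by rewrite -scalemxAl -scalemxAr.
rewrite -(courant_formDr oV Vx)//; last exact: smooth_mxCM.
apply: (courant_form_congr Vx) => // y Vy; first by rewrite addr0.
rewrite /B /B' /beta -!scalemxAl.
by mxlin.
Qed.

(** [F Y] lies in T^*_{0,1} of [J] and so kills [X]. Orthogonality is what makes the Courant bracket
    skew on these sections. *)
Lemma mixed_orthogonal y : V y ->
  (B' y *m Y y)^T *m X y + (B y *m X y)^T *m Y y = 0.
Proof.
move=> Vy; have -> : (B y *m X y)^T *m Y y = (B' y *m Y y)^T *m X y.
  by rewrite dotC dotM skB// /B scaleNr opprK.
rewrite /B' -scalemxAl trmxZ -scalemxAl.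
by rewrite (dot_T01_T10 (tr_JcF Vy (TY Vy)) (TX Vy)) scaler0 addr0.
Qed.

Lemma eigen_mixedC : eigen_i (JB x) (col_mx (lie_bracket Y X x)
  (courant_form Y (fun y => B' y *m Y y) X (fun y => B y *m X y) x)).
Proof.
rewrite lie_bracketC (courant_formC oV Vx sX sY); first last.
- exact: mixed_orthogonal.
- exact: smooth_mxCM.
- exact: smooth_mxCM.
by rewrite -opp_col_mx; apply: eigen_iN; exact: eigen_mixed.
Qed.

End Sections.

Lemma JB_involutive (u v : 'cV[R]_n -> 'cV[C]_(n + n)) :
  smooth_mxC V u -> smooth_mxC V v ->
  (forall x, V x -> eigen_i (JB x) (u x) /\ eigen_i (JB x) (v x)) ->
  forall x, V x -> eigen_i (JB x) (courant_bracket u v x).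
Proof.
move=> su sv Euv x Vx.
have scS : smooth_mxC V (fun y => complexify (invmx (S y))).
  apply: smooth_mxC_complexify => //; apply: smooth_invmx => //.
  apply: smooth_block_mx; try exact: smooth_mx_cst.
    by apply: smooth_mxN => //; exact: smooth_mxM.
  exact: smooth_mxM.
have cS y : complexify (invmx (S y)) = invmx (complexify (S y)).
  exact: map_invmx.
(* The inverse frame, being smooth, splits any smooth section of the eigenbundle into smooth
   sections of its two summands. *)
pose p w y : 'cV[C]_n := usubmx (complexify (invmx (S y)) *m w y).
pose m w y : 'cV[C]_n := dsubmx (complexify (invmx (S y)) *m w y).
have sp w : smooth_mxC V w -> smooth_mxC V (p w).
  by move=> sw; apply: smooth_mxC_usub => //; exact: smooth_mxCM.
have sm w : smooth_mxC V w -> smooth_mxC V (m w).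
  by move=> sw; apply: smooth_mxC_dsub => //; exact: smooth_mxCM.
have [spu smu spv smv] := And4 (sp _ su) (sm _ su) (sp _ sv) (sm _ sv).
have Tu y : V y -> T10 (J y) (p u y) /\ T10 (I y) (m u y).
  move=> Vy; rewrite /p /m cS; apply: eigen_JB_split => //.
  by have [] := Euv y Vy.
have Tv y : V y -> T10 (J y) (p v y) /\ T10 (I y) (m v y).
  move=> Vy; rewrite /p /m cS; apply: eigen_JB_split => //.
  by have [] := Euv y Vy.
have wE w y : V y -> T10 (J y) (p w y) /\ T10 (I y) (m w y) -> w y =
    col_mx (p w y + m w y) (B y *m p w y + B' y *m m w y).
  move=> Vy [T1 T2]; rewrite -frame_col// /p /m vsubmxK cS.
  by rewrite mulKVmx// complexify_unit// uS.
have uE w y : V y -> T10 (J y) (p w y) /\ T10 (I y) (m w y) ->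
    usubmx (w y) = p w y + m w y.
  by move=> Vy /(wE _ _ Vy) {1}->; rewrite col_mxKu.
have dE w y : V y -> T10 (J y) (p w y) /\ T10 (I y) (m w y) ->
    dsubmx (w y) = B y *m p w y + B' y *m m w y.
  by move=> Vy /(wE _ _ Vy) {1}->; rewrite col_mxKd.
clearbody p m; clear wE.
have scF : smooth_mxC V (fun y => cF y) by exact: smooth_mxC_complexify.
have sB : smooth_mxC V B by exact: smooth_mxCZ.
have sB' : smooth_mxC V B' by exact: smooth_mxCZ.
have clcF : closed_at x (fun y => cF y) by exact: closed_complexify (clF Vx).
have clB : closed_at x B by exact: closed_atZ.
have clB' : closed_at x B' by exact: closed_atZ.
have skB y : V y -> (B y)^T = - B y.
  by move=> Vy; exact: skew_complexify (FT Vy).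
have skB' y : V y -> (B' y)^T = - B' y.
  by move=> Vy; exact: skew_complexify (FT Vy).
rewrite courant_bracketE.
rewrite (lie_bracket_congr (X' := fun y => p u y + m u y)
  (Y' := fun y => p v y + m v y) Vx); first last.
- by move=> y Vy; apply: uE => //; exact: Tv.
- by move=> y Vy; apply: uE => //; exact: Tu.
rewrite (courant_form_congr (X' := fun y => p u y + m u y)
  (xi' := fun y => B y *m p u y + B' y *m m u y)
  (Y' := fun y => p v y + m v y)
  (eta' := fun y => B y *m p v y + B' y *m m v y) Vx); first last.
- by move=> y Vy; apply: dE => //; exact: Tv.
- by move=> y Vy; apply: uE => //; exact: Tv.
- by move=> y Vy; apply: dE => //; exact: Tu.
- by move=> y Vy; apply: uE => //; exact: Tu.
have sBp w : smooth_mxC V (p w) -> smooth_mxC V (fun y => B y *m p w y).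
  exact: smooth_mxCM.
have sBm w : smooth_mxC V (m w) -> smooth_mxC V (fun y => B' y *m m w y).
  exact: smooth_mxCM.
rewrite (lie_bracketDl oV Vx _ spu smu) !(lie_bracketDr oV Vx _ spv smv).
rewrite (courant_formDl oV Vx _ _ spu smu (sBp _ spu) (sBm _ smu)).
rewrite !(courant_formDr oV Vx _ _ _ _ (sBp _ spv) (sBm _ smv)).
rewrite -!add_col_mx; apply: eigen_iD; apply: eigen_iD.
- rewrite (courant_form_graph oV Vx sB)//; apply: eigen_JB_plus => //.
  apply: (J_involutive spu spv) => // y Vy.
  by have [? _] := Tu y Vy; have [? _] := Tv y Vy.
- by apply: eigen_mixed => // y Vy; [have [] := Tu y Vy|have [] := Tv y Vy].
- by apply: eigen_mixedC => // y Vy; [have [] := Tv y Vy|have [] := Tu y Vy].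
- rewrite (courant_form_graph oV Vx sB')//; apply: eigen_JB_minus => //.
  apply: (I_involutive smu smv) => // y Vy.
  by have [_ ?] := Tu y Vy; have [_ ?] := Tv y Vy.
Qed.

End Mixed.
End Involutivity.

(** * The generalized Kaehler structure *)

Lemma complexify_pair_inj (R : realType) p q (A B A' B' : 'M[R]_(p, q)) :
  complexify A + ('i%C : R[i]) *: complexify B =
  complexify A' + ('i%C : R[i]) *: complexify B' -> A = A' /\ B = B'.
Proof.
move=> e; split; apply/matrixP => i j;
  have := congr1 (fun X : 'M[R[i]]_(p, q) => X i j) e;
  rewrite !mxE => /eqP; rewrite eq_complex /=;
  rewrite !(mul0r, mul1r, mulr0, subr0, addr0, add0r).
  by case/andP => /eqP.
by case/andP => _ /eqP.
Qed.

Section Charts.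
Variables (R : realType) (n : nat) (M : manifold R n).
Variables I J F g : field M 'M[R]_n.
Hypotheses (endoI : endomorphism_field I) (endoJ : endomorphism_field J).
Hypothesis formF : two_form F.
Hypothesis FJ :
  forall c x, chart_image c x -> F c x *m J c x + (I c x)^T *m F c x = 0.
Hypothesis gE : forall c x, chart_image c x ->
  g c x + g c x = - (F c x *m I c x) - F c x *m J c x.
Hypothesis gpos : positive_definite_field g.

Lemma chart_open (c : chart M) : open (chart_image c).
Proof. exact: coord_open. Qed.

Lemma chart_imageE (c : chart M) p : dom c p -> chart_image c (Defs.coord c p).
Proof. by move=> dp; exists p. Qed.

Let FT c x : chart_image c x -> (F c x)^T = - F c x.
Proof. by case: formF => _ _; apply. Qed.

Local Notation S c x := (frame (I c x) (J c x) (F c x)).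

Let uF c x (cx : chart_image c x) : F c x \in unitmx :=
  form_unit (gE cx) (gpos cx).
Let uS c x (cx : chart_image c x) : S c x \in unitmx.
Proof.
(* The frame does not mention [b], so any matrix with the prescribed double serves. *)
pose b0 := 2^-1 *: (F c x *m I c x - F c x *m J c x).
exact: (frame_unit (b := b0) (gE cx) (double_half _) (gpos cx)).
Qed.

(** In the transformation law of [F] the left-hand side is invertible, hence so is the factor [D];
    the chain rule for transition maps is avoided. *)
Lemma transition_unit (c d : chart M) p : dom c p -> dom d p ->
  transition_jac c d (Defs.coord c p) \in unitmx.
Proof.
move=> cp dp; have [_ tF _] := formF.
have := uF (chart_imageE cp); rewrite (tF _ _ _ cp dp) unitmx_mul.
by case/andP.
Qed.

(** The lifts of T to C_+ and C_- are canonical, so in frame coordinates a change of chart is [D] on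
    each half. *)
Lemma frame_transition (c d : chart M) p : dom c p -> dom d p ->
  let D := transition_jac c d (Defs.coord c p) in
  S d (Defs.coord d p) *m diag_block D D =
  transition_TTs c d (Defs.coord c p) *m S c (Defs.coord c p).
Proof.
move=> cp dp D; have uD : D \in unitmx := transition_unit cp dp.
have [_ tF _] := formF; have := tF _ _ _ cp dp; rewrite -/D /= => tFD.
have tI : I d (Defs.coord d p) *m D = D *m I c (Defs.coord c p).
  exact: endoI.2.
have tJ : J d (Defs.coord d p) *m D = D *m J c (Defs.coord c p).
  exact: endoJ.2.
have lift (E E' : 'M[R]_n) : E *m D = D *m E' ->
    F d (Defs.coord d p) *m E *m D =
    (invmx D)^T *m (F c (Defs.coord c p) *m E').
  move=> ED; rewrite tFD -!mulmxA -ED !mulmxA.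
  by rewrite -trmx_mul mulmxV// trmx1 mul1mx.
rewrite /transition_TTs -/D /frame /diag_block !mulmx_block !mul1mx.
rewrite !mulmx0 !mul0mx !mulmx1 !addr0 !add0r mulNmx mulmxN.
by rewrite (lift _ _ tI) (lift _ _ tJ).
Qed.

(** * Structures that are diagonal in the frame, to be used with (P, N) = (J, - I) and (J, I) *)

Section Structure.
Variables (A : field M 'M[R]_(n + n)) (P N : field M 'M[R]_n).
Hypothesis AS : forall c x, chart_image c x ->
  A c x *m S c x = S c x *m diag_block (P c x) (N c x).
Hypotheses (endoP : endomorphism_field P) (endoN : endomorphism_field N).
Hypothesis PP : forall c x, chart_image c x -> P c x *m P c x = - 1%:M.
Hypothesis NN : forall c x, chart_image c x -> N c x *m N c x = - 1%:M.
Hypothesis Pg : forall c x, chart_image c x ->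
  (P c x)^T *m g c x *m P c x = g c x.
Hypothesis Ng : forall c x, chart_image c x ->
  (N c x)^T *m g c x *m N c x = g c x.

Lemma structure_frame_col c x (a a' : 'cV[R]_n) : chart_image c x ->
  A c x *m (S c x *m col_mx a a') =
  S c x *m col_mx (P c x *m a) (N c x *m a').
Proof. by move=> cx; rewrite mulmxA AS// -mulmxA diag_block_col. Qed.

Lemma frame_coordinates c x (u : 'cV[R]_(n + n)) : chart_image c x ->
  exists a a', u = S c x *m col_mx a a'.
Proof.
move=> cx; pose w := invmx (S c x) *m u.
by exists (usubmx w), (dsubmx w); rewrite vsubmxK /w mulKVmx// uS.
Qed.

(** Every clause except involutivity is checked in frame coordinates; involutivity is left as a
    premise because its proof differs for the two structures. *)
Lemma structure_complex :
  (forall (c : chart M) (V : set 'cV[R]_n)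
          (u v : 'cV[R]_n -> 'cV[R[i]]_(n + n)),
     open V -> V `<=` chart_image c -> smooth_mxC V u -> smooth_mxC V v ->
     (forall x, V x -> eigen_i (A c x) (u x) /\ eigen_i (A c x) (v x)) ->
     forall x, V x -> eigen_i (A c x) (courant_bracket u v x)) ->
  generalized_complex A.
Proof.
move=> inv; split => //.
- move=> c; have oc := @chart_open c; have [sF _ _] := formF.
  have sS : smooth_mx (chart_image c) (fun x => S c x).
    apply: smooth_block_mx; try exact: smooth_mx_cst.
      by apply: smooth_mxN => //; apply: smooth_mxM => //; exact: endoJ.1.
    by apply: smooth_mxM => //; exact: endoI.1.
  apply: (smooth_mx_congr (A := fun x =>
    S c x *m diag_block (P c x) (N c x) *m invmx (S c x))) => //.
    by move=> x cx; rewrite -(AS cx) (mulmxK (uS cx)).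
  apply: smooth_mxM => //; last by apply: smooth_invmx => // x cx; exact: uS.
  apply: smooth_mxM => //; apply: smooth_block_mx; try exact: smooth_mx_cst.
    exact: endoP.1.
  exact: endoN.1.
- move=> c d p cp dp /=; set T := transition_TTs _ _ _.
  have cx := chart_imageE cp; have dx := chart_imageE dp.
  pose D := transition_jac c d (Defs.coord c p).
  have tS : S d (Defs.coord d p) *m diag_block D D = T *m S c (Defs.coord c p).
    exact: frame_transition.
  have tP : P d (Defs.coord d p) *m D = D *m P c (Defs.coord c p).
    exact: endoP.2.
  have tN : N d (Defs.coord d p) *m D = D *m N c (Defs.coord c p).
    exact: endoN.2.
  apply: (can_inj (mulmxK (uS cx))).
  rewrite -!mulmxA AS// -tS (mulmxA T) -tS mulmxA AS// -!mulmxA.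
  by rewrite !diag_blockM tP tN.
- move=> c x cx u v; have [a [a' ->]] := frame_coordinates u cx.
  have [e [e' ->]] := frame_coordinates v cx.
  rewrite !structure_frame_col// !(pairing_frame (FT cx) (FJ cx) (gE cx)).
  have tr (E : 'M[R]_n) (r s : 'cV[R]_n) : E^T *m g c x *m E = g c x ->
      (E *m r)^T *m g c x *m (E *m s) = r^T *m g c x *m s.
    by move=> Eg; rewrite trmx_mul -[in RHS]Eg !mulmxA.
  by rewrite !tr ?Pg ?Ng.
- move=> c x cx; apply: (can_inj (mulmxK (uS cx))).
  rewrite -mulmxA AS// mulmxA AS// -mulmxA diag_blockM PP// NN//.
  have -> : diag_block (- 1%:M) (- 1%:M) = - 1%:M :> 'M[R]_(n + n).
    by rewrite -[in RHS]diag_block_scalar /diag_block opp_block_mx oppr0.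
  by rewrite mulmxN mulmx1 mulNmx mul1mx.
Qed.

End Structure.

(** * Commutation and the generalized metric *)

Section Metric.
Variables JA JB : field M 'M[R]_(n + n).
Hypothesis JAS : forall c x, chart_image c x ->
  JA c x *m S c x = S c x *m diag_block (J c x) (- I c x).
Hypothesis JBS : forall c x, chart_image c x ->
  JB c x *m S c x = S c x *m diag_block (J c x) (I c x).

Lemma structures_commute c x : chart_image c x ->
  JA c x *m JB c x = JB c x *m JA c x.
Proof.
move=> cx; apply: (can_inj (mulmxK (uS cx))).
rewrite -!mulmxA JAS// JBS// !mulmxA JAS// JBS// -!mulmxA !diag_blockM.
by rewrite mulmxN mulNmx.
Qed.

Let E c x : 'M[R]_(n + n, n) := col_mx 1%:M (- (F c x *m J c x)).

Let C_plus : field M (set 'cV[R]_(n + n)) :=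
  fun c x => [set u | exists a : 'cV[R]_n, u = E c x *m a].

Lemma frame_plus c x (a : 'cV[R]_n) : S c x *m col_mx a 0 = E c x *m a.
Proof. by rewrite mul_block_col !mulmx0 !addr0 mul_col_mx. Qed.

Lemma pairing_frame_chart c x (a a' e e' : 'cV[R]_n) : chart_image c x ->
  pairing (S c x *m col_mx a a') (S c x *m col_mx e e') =
  2 * ((a^T *m g c x *m e) 0 0 - (a'^T *m g c x *m e') 0 0).
Proof. by move=> cx; rewrite (pairing_frame (FT cx) (FJ cx) (gE cx)). Qed.

Lemma C_plus_subbundle : subbundle C_plus.
Proof.
split=> [c d p cp dp u | c x0 cx0].
  set T := transition_TTs _ _ _; pose D := transition_jac c d (Defs.coord c p).
  have uD : D \in unitmx := transition_unit cp dp.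
  have uT : T \in unitmx.
    rewrite unitmxE det_ublock unitrM -!unitmxE uD.
    by rewrite unitmx_tr unitmx_inv.
  have tE (a : 'cV[R]_n) :
      T *m (E c (Defs.coord c p) *m a) = E d (Defs.coord d p) *m (D *m a).
    rewrite -!frame_plus mulmxA -frame_transition// -mulmxA diag_block_col.
    by rewrite mulmx0.
  split=> [[a ->]|[a Tu]]; first by exists (D *m a).
  exists (invmx D *m a); apply: (can_inj (mulKmx uT)).
  by rewrite tE mulKVmx.
exists n, (chart_image c), (E c); split=> //; first exact: chart_open.
  move=> i j.
  have sFJ : smooth_mx (chart_image c) (fun x => - (F c x *m J c x)).
    have oc := @chart_open c; have [sF _ _] := formF.
    by apply: smooth_mxN => //; apply: smooth_mxM => //; exact: endoJ.1.
  case: (split_ordP i) => i' ->.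
    by under eq_fun do rewrite col_mxEu; exact: smooth_cst.
  by under eq_fun do rewrite col_mxEd; exact: sFJ.
move=> x cx; split=> //; apply/eqP; rewrite eqn_leq rank_leq_col /=.
(* The projection to T is a left inverse of the lift. *)
have r1 : \rank (row_mx 1%:M 0 *m E c x) = n.
  by rewrite mul_row_col mul1mx mul0mx addr0 mxrank1.
by rewrite -[leqLHS]r1 mxrankM_maxr.
Qed.

(** If a larger subbundle contained a vector outside C_+, subtracting its C_+ part would leave a
    nonzero vector of C_-, on which the pairing is negative. *)
Lemma C_plus_maximal : maximal_positive_definite C_plus.
Proof.
split; first exact: C_plus_subbundle.
  move=> c x cx u [a ->] u0; rewrite -frame_plus pairing_frame_chart//.
  rewrite mulmx0 [X in _ - X]mxE subr0 mulr_gt0// gpos//.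
  by apply: contra_neq u0 => ->; rewrite mulmx0.
move=> C' [_ locC'] posC' CC' c x cx; apply/seteqP; split; last exact: CC'.
move=> u C'u; have [a [a' uE]] := frame_coordinates u cx.
suff a'0 : a' = 0 by exists a; rewrite uE a'0 frame_plus.
apply/eqP; apply: contraT => a'0.
have C'a' : C' c x (S c x *m col_mx 0 a').
  (* A fibre of [C'] is a priori just a set; its local frame shows that it is closed under
     subtraction. *)
  have [k [V [E' [_ Vx _ _ E'P]]]] := locC' c x cx.
  have [_ C'E] := E'P x Vx; rewrite C'E in C'u *; case: C'u => r ur.
  have : C' c x (S c x *m col_mx a 0).
    by apply: CC' => //; exists a; rewrite frame_plus.
  rewrite C'E => -[s sE]; exists (r - s).
  rewrite mulmxBr -ur -sE uE -mulmxBr opp_col_mx add_col_mx subrr subr0.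
  by [].
have S0 : S c x *m col_mx 0 a' != 0.
  apply: contra_neq a'0 => /(congr1 (mulmx (invmx (S c x)))).
  rewrite mulKmx ?uS// mulmx0 -[X in _ = X -> _]col_mx0 => /eq_col_mx.
  by case.
have := posC' c x cx _ C'a' S0; rewrite pairing_frame_chart// mulmx0.
rewrite [X in X - _]mxE sub0r pmulr_rgt0// oppr_gt0 => lt0.
by have := lt_trans lt0 (gpos cx a'0); rewrite ltxx.
Qed.

Hypothesis Ig : forall c x, chart_image c x ->
  (I c x)^T *m g c x *m I c x = g c x.
Hypothesis Jg : forall c x, chart_image c x ->
  (J c x)^T *m g c x *m J c x = g c x.

Lemma structures_metric : generalized_metric (M := M)
  (fun c x u v => pairing (JA c x *m u) (JB c x *m v)).
Proof.
exists C_plus; split; first exact: C_plus_maximal.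
have tr (G E' : 'M[R]_n) (r s : 'cV[R]_n) : E'^T *m G *m E' = G ->
    (E' *m r)^T *m G *m (E' *m s) = r^T *m G *m s.
  by move=> Eg; rewrite trmx_mul -[in RHS]Eg !mulmxA.
move=> c x cx _ _ u2 v2 [a ->] [e ->] Cu2 Cv2.
have orth u : orthogonal_complement (C_plus c x) u ->
    exists a', u = S c x *m col_mx 0 a'.
  move=> Cu; have [r [r' uE]] := frame_coordinates u cx; exists r'.
  suff r0 : r = 0 by rewrite uE r0.
  apply/eqP; apply: contraT => r0.
  (* Pairing [u] with its own C_+ part yields [2 g(r, r)], so [r] vanishes by positivity. *)
  have := Cu (E c x *m r) (ex_intro _ r erefl).
  rewrite uE -frame_plus pairing_frame_chart// mulmx0 [X in _ - X]mxE subr0.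
  by move/eqP; rewrite mulf_eq0 pnatr_eq0 /= gt_eqF// gpos.
have [a' ->] := orth _ Cu2; have [e' ->] := orth _ Cv2.
rewrite -!frame_plus -!mulmxDr !add_col_mx !addr0 !add0r.
rewrite (structure_frame_col JAS)// (structure_frame_col JBS)//.
rewrite !pairing_frame_chart// mulNmx trmxN !mulNmx !tr ?Ig ?Jg//.
have N0 (m : 'M[R]_1) : (- m) 0 0 = - m 0 0 by exact: mxE.
have z0 : (0 : 'M[R]_1) 0 0 = 0 by exact: mxE.
by rewrite !mulmx0 N0 z0 subr0 sub0r -mulrBr.
Qed.

End Metric.
End Charts.
Theorem theorem6p2 (R : realType) (n : nat) (M : manifold R n)
    (I J Q F : field M 'M[R]_n)
    (hI : complex_structure I) (hJ : complex_structure J)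
    (hQ : real_poisson Q)
    (hIQ : holomorphic_poisson I (fun c x =>
       complexify (I c x *m Q c x) + ('i%C : R[i]) *: complexify (Q c x)))
    (hJQ : holomorphic_poisson J (fun c x =>
       complexify (J c x *m Q c x) + ('i%C : R[i]) *: complexify (Q c x)))
    (hF : closed_two_form F)
    (hJI : forall c x, chart_image c x -> J c x - I c x = Q c x *m F c x)
    (hFJ : forall c x, chart_image c x ->
       F c x *m J c x + (I c x)^T *m F c x = 0) :
  let g : field M 'M[R]_n :=
    fun c x => - (2^-1 *: (F c x *m (I c x + J c x))) in
  positive_definite_field g ->
  let wI : field M 'M[R]_n := fun c x => g c x *m I c x in
  let wJ : field M 'M[R]_n := fun c x => g c x *m J c x in
  let b : field M 'M[R]_n :=
    fun c x => - (2^-1 *: (F c x *m (J c x - I c x))) in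
  let JB : field M 'M[R]_(n + n) := fun c x =>
    2^-1 *: (block_mx 1%:M 0 (b c x) 1%:M *m
      block_mx (J c x + I c x) (- (invmx (wJ c x) - invmx (wI c x)))
               (wJ c x - wI c x) (- ((J c x)^T + (I c x)^T)) *m
      block_mx 1%:M 0 (- b c x) 1%:M) in
  let JA : field M 'M[R]_(n + n) := fun c x =>
    2^-1 *: (block_mx 1%:M 0 (b c x) 1%:M *m
      block_mx (J c x - I c x) (- (invmx (wJ c x) + invmx (wI c x)))
               (wJ c x + wI c x) (- ((J c x)^T - (I c x)^T)) *m
      block_mx 1%:M 0 (- b c x) 1%:M) in
  two_form b /\ generalized_kaehler JA JB.
Proof.
move=> g gpos wI wJ b JB JA.
have [endoI II I_inv] := hI; have [endoJ JJ J_inv] := hJ.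
have [formF clF] := hF; have [sF tF FT] := formF.
have [_ [[_ _ skew] _ holo] _] := hJQ.
have [[sQ _ _] _] := hQ.
(* The real part of the skewness of [J Q + i Q] says that [J Q] is skew, and the imaginary part that
   [Q] is; together they give the commutation. *)
have JQ c x : chart_image c x -> J c x *m Q c x = Q c x *m (J c x)^T.
  move=> cx; have := skew c x cx; rewrite trmxD trmxZ -!complexify_tr opprD.
  rewrite -scalerN -!complexifyN => /complexify_pair_inj[].
  by rewrite trmx_mul => e1 e2; rewrite e2 mulNmx in e1; exact: oppr_inj.
have smQ c : smooth_mx (chart_image c) (Q c).
  move=> i j; have [s _] := sQ c i j.
  by apply: smooth_congr s => [|x _]; [exact: chart_open|rewrite mxE].
have gE c x : g c x + g c x = - (F c x *m I c x) - F c x *m J c x.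
  by rewrite /g -opprD double_half mulmxDr opprD.
have bE c x : b c x + b c x = F c x *m I c x - F c x *m J c x.
  by rewrite /b -opprD double_half mulmxBr opprB.
have Ig c x (cx : chart_image c x) :=
  metric_I (II c x cx) (JJ c x cx) (hFJ c x cx) (gE c x).
have Jg c x (cx : chart_image c x) :=
  metric_J (II c x cx) (JJ c x cx) (FT c x cx) (hFJ c x cx) (gE c x).
have JAS c x (cx : chart_image c x) : JA c x *m frame (I c x) (J c x) (F c x) =
    frame (I c x) (J c x) (F c x) *m diag_block (J c x) (- I c x).
  exact: (JA_frame (II c x cx) (JJ c x cx) (FT c x cx) (hFJ c x cx) (gE c x)
    (bE c x) (gpos c x cx)).
have JBS c x (cx : chart_image c x) : JB c x *m frame (I c x) (J c x) (F c x) =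
    frame (I c x) (J c x) (F c x) *m diag_block (J c x) (I c x).
  exact: (JB_frame (II c x cx) (JJ c x cx) (FT c x cx) (hFJ c x cx) (gE c x)
    (bE c x) (gpos c x cx)).
have uF c x (cx : chart_image c x) := form_unit (gE c x) (gpos c x cx).
have uS c x (cx : chart_image c x) :=
  frame_unit (gE c x) (bE c x) (gpos c x cx).
have JAE c x (cx : chart_image c x) :
    JA c x = block_mx 0 (- invmx (F c x)) (F c x) 0.
  exact: (JA_symplectic (II c x cx) (JJ c x cx) (FT c x cx) (hFJ c x cx)
    (gE c x) (bE c x) (gpos c x cx)).
have gE' c x (_ : chart_image c x) := gE c x.
have endoNI : endomorphism_field (M := M) (fun c x => - I c x).
  split=> [c|c d p cp dp /=].
    by apply: smooth_mxN; [exact: chart_open|exact: endoI.1].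
  by rewrite mulNmx mulmxN; congr (- _); exact: endoI.2.
split.
  split=> [c|c d p cp dp /=|c x cx].
  - have oc := @chart_open _ _ _ c.
    apply: smooth_mxN => //; apply: smooth_mxZ => //; apply: smooth_mxM => //.
    apply: smooth_mxD => //; first exact: endoJ.1.
    by apply: smooth_mxN => //; exact: endoI.1.
  - have tI := endoI.2 c d p cp dp; have tJ := endoJ.2 c d p cp dp.
    rewrite /= in tI tJ; rewrite /b (tF c d p cp dp) /=.
    set D := transition_jac _ _ _ in tI tJ *.
    rewrite -!mulmxA mulmxBr -tI -tJ -mulmxBl !mulmxA mulmxN mulNmx.
    by rewrite -scalemxAr -scalemxAl !mulmxA.
  - exact: (b_tr (FT c x cx) (hFJ c x cx) (bE c x)).
split.
- apply: (structure_complex endoI endoJ formF hFJ gE' gpos JAS endoJ endoNI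
    JJ) => //.
  + by move=> c x cx; rewrite mulNmx mulmxN opprK II.
  + by move=> c x cx; rewrite trmxN !mulNmx mulmxN opprK Ig.
  (* In symplectic form the structure involves [F] alone, so only its closedness is at stake. *)
  move=> c V u v oV Vc su sv Euv x Vx; rewrite JAE; last exact: Vc.
  apply: (symplectic_involutive oV _ _ _ _ su sv _ Vx).
  + exact: smooth_mx_subset (sF c).
  + by move=> y /Vc; exact: FT.
  + by move=> y /Vc; exact: uF.
  + by move=> y /Vc; exact: clF.
  + by move=> y Vy; rewrite -JAE; [exact: Euv|exact: Vc].
- apply: (structure_complex endoI endoJ formF hFJ gE' gpos JBS endoJ endoI
    JJ) => //.
  move=> c V u v oV Vc su sv Euv x Vx.
  apply: (@JB_involutive _ _ V oV (I c) (J c) (Q c) (F c) (JB c)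
    _ _ _ _ _ _ _ _ _ _ _ _ _ _ _ _ u v su sv Euv x Vx).
  + exact: smooth_mx_subset (endoI.1 c).
  + exact: smooth_mx_subset (endoJ.1 c).
  + exact: smooth_mx_subset (smQ c).
  + exact: smooth_mx_subset (sF c).
  + by move=> y /Vc; exact: JJ.
  + by move=> y /Vc; exact: JQ.
  + by move=> y /Vc; exact: hJI.
  + by move=> y /Vc; exact: hFJ.
  + by move=> y /Vc; exact: FT.
  + by move=> y /Vc; exact: uF.
  + by move=> y /Vc; exact: uS.
  + by move=> y /Vc; exact: JBS.
  + by move=> y /Vc; exact: clF.
  + by move=> X Y; exact: I_inv.
  + by move=> X Y; exact: J_inv.
  + by move=> Z; exact: holo.
- by move=> c x cx; exact: (structures_commute gE' gpos JAS JBS).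
- exact: (structures_metric endoI endoJ formF hFJ gE' gpos JAS JBS Ig Jg).
Qed.
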